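(* Let $\sigma,\sigma'\in\mathbf S_n^2$ be such that $\sigma'$ is a generalized descendant of $\sigma$. Then $\operatorname{codim}_{\overline{\mathcal B}_\sigma}\mathcal B_{\sigma'}=1$. Thus: (i) For $\sigma,\sigma'\in\mathbf S_n^2$ with $\sigma\succ\sigma'$, any chain between $\sigma$ and $\sigma'$ is of length equal to $\operatorname{codim}_{\overline{\mathcal B}_\sigma}(\mathcal B_{\sigma'})$. (ii) In particular, for any $\sigma\in\mathbf S_n^2(l)$ where $l\ge k$, $\mathrm{depth}_k(\sigma)$ is well defined and $\mathrm{depth}_k(\sigma)=\operatorname{codim}_{\overline{\mathcal B}_\sigma}\mathcal B_{\sigma_o(k)}$. (iii) In particular, $\mathrm{depth}_0(\sigma)=\dim\mathcal B_\sigma$ for every $\sigma\in\mathbf S_n^2$.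
   Context: Work over $\mathbb C$. $\mathbf B\subset GL_n$ is the group of invertible upper-triangular $n\times n$ matrices, acting by conjugation on the space $\mathfrak n$ of strictly upper-triangular $n\times n$ matrices. $\mathbf S_n^2=\{\sigma\in \mathbf S_n:\sigma^2=\mathrm{Id}\}$ (including $\mathrm{Id}$), and $\mathbf S_n^2(k)$ ($0\le k\le n/2$) is the subset of those $\sigma$ that are products of exactly $k$ disjoint 2-cycles. For $\sigma\in\mathbf S_n^2$, $N_\sigma\in\mathfrak n$ is the matrix with $(N_\sigma)_{i,j}=1$ if $i<j$ and $\sigma(i)=j$, and $0$ otherwise. $\mathcal B_\sigma=\{bN_\sigma b^{-1}: b\in\mathbf B\}$ is its $\mathbf B$-orbit, and $\overline{\mathcal B}_\sigma$ its Zariski closure. Rank matrix: $R_\sigma$ is the $n\times n$ matrix with $(R_\sigma)_{i,j}=0$ for $i\ge j$ and, for $i<j$, $(R_\sigma)_{i,j}$ equal to the rank of the submatrix of $N_\sigma$ with rows and columns $i,\dots,j$ (equivalently the number of 2-cycles of $\sigma$ with both entries in $\{i,\dots,j\}$). Partial order on $\mathbf S_n^2$: $\sigma'\preceq\sigma$ if $(R_{\sigma'})_{i,j}\le (R_\sigma)_{i,j}$ for all $i,j$; $\sigma'\prec\sigma$ means $\sigma'\preceq\sigma$ and $\sigma'\ne\sigma$. (It is known that $\sigma'\preceq\sigma$ iff $\mathcal B_{\sigma'}\subseteq\overline{\mathcal B}_\sigma$.) $\sigma'\in\mathbf S_n^2$ is a generalized descendant of $\sigma\in\mathbf S_n^2$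 if $\sigma'\prec\sigma$ and, for $\phi\in\mathbf S_n^2$, $\sigma'\preceq\phi\preceq\sigma$ implies $\phi=\sigma$ or $\phi=\sigma'$ (the numbers of 2-cycles of $\sigma$ and $\sigma'$ may differ). A chain between $\sigma$ and $\sigma'$ is a sequence $\sigma=\sigma_m\succ\sigma_{m-1}\succ\cdots\succ\sigma_0=\sigma'$ in $\mathbf S_n^2$ where $\sigma_{i-1}$ is a generalized descendant of $\sigma_i$ for $1\le i\le m$; $m$ is its length. $\sigma_o(k)=(1,n-k+1)(2,n-k+2)\cdots(k,n)\in\mathbf S_n^2(k)$, with $\sigma_o(0)=\mathrm{Id}$; it is the minimum of $\bigsqcup_{j\ge k}\mathbf S_n^2(j)$ for $\preceq$. For $\sigma\in\mathbf S_n^2(j)$ with $j\ge k$, $\mathrm{depth}_k(\sigma)$ is the length of a chain between $\sigma$ and $\sigma_o(k)$; it is $0$ if $\sigma=\sigma_o(k)$. $\operatorname{codim}_{\overline{\mathcal B}_\sigma}\mathcal B_{\sigma'}=\dim\mathcal B_\sigma-\dim\mathcal B_{\sigma'}$. *)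

(* Defs.v *)
From HB Require Import structures.
From mathcomp Require Import all_boot all_order all_algebra all_fingroup.
From mathcomp Require Import complex mpoly.
From mathcomp Require Import boolp classical_sets reals.

Set Implicit Arguments.
Unset Strict Implicit.
Unset Printing Implicit Defensive.

Import Order.TTheory GRing.Theory Num.Theory.

Local Open Scope ring_scope.

Section Zariski.
Variables (F : fieldType) (n : nat).
Implicit Types (Z : set 'M[F]_n) (p : {mpoly F[n * n]}).

(* The coordinates on n x n matrices are the entries, in the order of mxvec. *)
Definition mxeval p (X : 'M[F]_n) : F := p.@[fun k => mxvec X 0 k].

Definition vanishing_ideal Z : set {mpoly F[n * n]} :=
  [set p | forall X, Z X -> mxeval p X = 0]%classic.

(* The classes of f_1, ..., f_d in the ring F[x] / I(Z) of polynomial functions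
   on Z are algebraically independent over F. *)
Definition alg_indep_on Z (d : nat) (f : d.-tuple {mpoly F[n * n]}) : Prop :=
  forall P : {mpoly F[d]}, vanishing_ideal Z (comp_mpoly f P) -> P = 0.

(* Over an algebraically closed field, the dimension of the variety Z is the
   transcendence degree over F of its coordinate ring F[x] / I(Z), i.e. the
   maximal number of algebraically independent elements of that ring.  Since Z
   and its Zariski closure have the same ideal, this also applies to locally
   closed sets such as orbits. *)
Definition has_dim Z (d : nat) : Prop :=
  (exists f : d.-tuple {mpoly F[n * n]}, alg_indep_on Z f) /\
  (forall e (g : e.-tuple {mpoly F[n * n]}), alg_indep_on Z g -> (e <= d)%N).

(* The default value 0 is only reached for the empty set, as otherwise the
   transcendence degree lies between 0 and n * n. *)
Definition var_dim Z : nat := xget 0%N [set d | has_dim Z d]%classic.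

End Zariski.

Section Involutions.
Variable n : nat.
Implicit Types s : 'S_n.

Definition invol : {set 'S_n} := [set s : 'S_n | s ^+ 2 == 1]%g.

Definition two_cycles s : {set {set 'I_n}} := [set c in porbits s | #|c| == 2%N].

Definition involk (k : nat) : {set 'S_n} :=
  [set s in invol | #|two_cycles s| == k].

(* With entries numbered from 0, the transpositions (i, n - k + i) for i < k.
   This is the intended permutation when k <= n / 2. *)
Definition sigma_o (k : nat) : 'S_n :=
  (\prod_(i < n | (i < k)%N) \prod_(j < n | (j == n - k + i :> nat)%N)
    tperm i j)%g.

End Involutions.

Section BorelOrbits.
Variables (R : realType) (n : nat).
Local Notation C := R[i].
Implicit Types s t : 'S_n.

Definition borel (b : 'M[C]_n) : Prop :=
  (b \in unitmx) /\ (forall i j : 'I_n, (j < i)%N -> b i j = 0).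

Definition Nmx s : 'M[C]_n := \matrix_(i, j) ((i < j)%N && (s i == j))%:R.

Definition Borbit s : set 'M[C]_n :=
  [set X | exists2 b, borel b & X = b *m Nmx s *m invmx b]%classic.

Definition codim s t : int := (var_dim (Borbit s))%:Z - (var_dim (Borbit t))%:Z.

Definition idx_range (i j : 'I_n) : {set 'I_n} := [set k : 'I_n | (i <= k <= j)%N].

Definition principal_submx (A : {set 'I_n}) (M : 'M[C]_n) : 'M[C]_#|A| :=
  mxsub (fun a => enum_val a) (fun a => enum_val a) M.

Definition rankmx s : 'M[nat]_n :=
  \matrix_(i, j)
    if (i < j)%N then \rank (principal_submx (idx_range i j) (Nmx s)) else 0%N.

Definition inv_le : rel 'S_n :=
  fun t s => [forall i, forall j, (rankmx t i j <= rankmx s i j)%N].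

Definition inv_lt : rel 'S_n := fun t s => inv_le t s && (t != s).

(* gen_desc s t : t is a generalized descendant of s. *)
Definition gen_desc : rel 'S_n := fun s t =>
  [&& s \in invol n, t \in invol n, inv_lt t s &
   [forall phi in invol n,
     (inv_le t phi && inv_le phi s) ==> (phi == s) || (phi == t)]].

(* The chain s = s_m > s_(m-1) > ... > s_0 = t is represented by the sequence
   c = [:: s_(m-1); ...; s_0], so its length m is size c. *)
Definition is_chain s t (c : seq 'S_n) : Prop :=
  path gen_desc s c /\ last s c = t.

(* depth_k(s) is well defined and equal to d. *)
Definition depth_eq (k : nat) s (d : nat) : Prop :=
  (exists c, is_chain s (sigma_o n k) c) /\
  (forall c, is_chain s (sigma_o n k) c -> size c = d).

End BorelOrbits.

Arguments codim R {n} s t.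
Arguments Borbit R {n} s.
Arguments Nmx R {n} s.
Arguments rankmx R {n} s.
Arguments inv_le R {n}.
Arguments inv_lt R {n}.
Arguments gen_desc R {n}.
Arguments is_chain R {n} s t c.
Arguments depth_eq R {n} k s d.

(* Main.v *)
(* Dimension: write N for N_s.  The upper triangular matrices commuting with N
   form an algebra A cut out by equations between disjoint sets of entries, so
   it has coordinates indexed by an explicit set I of pairs (p, q), p <= q.
   Every upper triangular invertible b can be multiplied on the right by an
   element of A so that b becomes the identity on I; hence the orbit is the
   image of a polynomial map in the d = n(n+1)/2 - #I remaining coordinates,
   and its dimension is at most d.  The differential of this map at the base
   point N is injective (it is x |-> [x, N] on a complement of A), so d linear
   functions are algebraically independent on the orbit.

   Combinatorics: it remains to see that #I increases by exactly 1 along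
   covers.  View fixed points as arcs ending at infinity.  If t < s, then one
   of three moves (swapping the left ends of two nested arcs, exchanging the
   two inner ends of two disjoint arcs, cutting an arc) applied to the leftmost
   arc of s violated by t gives f with t <= f < s, and for a suitable choice of
   the second arc the move raises #I by 1. *)

Require Import Defs.
From HB Require Import structures.
From mathcomp Require Import all_boot all_order all_algebra all_fingroup.
From mathcomp Require Import complex mpoly boolp classical_sets reals.
From mathcomp Require Import zify.
Import Order.TTheory GRing.Theory Num.Theory.

Set Implicit Arguments.
Unset Strict Implicit.
Unset Printing Implicit Defensive.

(** * Link patterns and the moves between them *)

Section Links.
Variable n : nat.
Implicit Types s f : 'S_n.

Definition nonright s := [set k : 'I_n | k <= s k].
(* A fixed point is a link with right end at infinity, encoded as [n]. *)
Definition mate s (k : 'I_n) : nat := if k < s k then s k : nat else n.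
Definition link s (k : 'I_n) : nat * nat := (k : nat, mate s k).
Definition links s : seq (nat * nat) := map (link s) (enum (nonright s)).
Definition arcs_in s (a b : nat) : nat :=
  #|[set k : 'I_n | [&& a <= k, k < s k & s k <= b]]|.
(* The number of pairs contributed by the links [g] and [h], in this order, to
   [stab_pairs]; a fixed point is its own right end in the first term. *)
Definition weight (g h : nat * nat) : nat :=
  (g.1 <= (if h.2 < n then h.2 else h.1))
  + [&& g.2 < n, h.2 < n, g.1 <= h.1 & g.2 <= h.2].
(** This is the size of [stab_pairs] ([card_stab_pairs]), written so that a move only affects pairs
    containing a moved link. *)
Definition link_weight (G : seq (nat * nat)) : nat :=
  \sum_(g <- G) \sum_(h <- G) weight g h.

Lemma link_weight_cat A L : link_weight (A ++ L) =
  link_weight A + link_weight L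
  + \sum_(g <- L) \sum_(a <- A) (weight a g + weight g a).
Proof.
rewrite /link_weight big_cat /=.
under eq_bigr do rewrite big_cat /=.
under [X in _ + X = _]eq_bigr do rewrite big_cat /=.
rewrite !big_split /= [X in _ + X + _ = _]exchange_big /=.
under [X in _ = _ + X]eq_bigr do rewrite big_split.
rewrite big_split /=. lia.
Qed.

Lemma perm_link_weight G H : perm_eq G H -> link_weight G = link_weight H.
Proof.
move=> e; rewrite /link_weight (perm_big _ e) /=.
by apply: eq_bigr => g _; rewrite (perm_big _ e).
Qed.

Lemma arcs_inE s a b : b < n ->
  arcs_in s a b = \sum_(g <- links s) ((a <= g.1) && (g.2 <= b)).
Proof.
move=> bn; rewrite /links big_map big_enum_cond /= -big_mkcondr /= /arcs_in.
rewrite -sum1_card; apply: eq_bigl => k; rewrite !inE /mate.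
by case: ltnP => h; case: (leqP k (s k)); lia.
Qed.

Lemma links_split s (P : {set 'I_n}) (K : seq 'I_n) : uniq K ->
  {subset K <= P} -> {in P, forall k, (k \in K) = (k <= s k)} ->
  perm_eq (links s) (map (link s) K ++ map (link s) (enum (nonright s :\: P))).
Proof.
move=> uK KP eK; rewrite -map_cat perm_map // uniq_perm ?enum_uniq //.
  rewrite cat_uniq uK enum_uniq andbT /=; apply/hasPn => k.
  by rewrite mem_enum inE => /andP[kP _]; apply: contra kP => /KP.
move=> k; rewrite mem_cat !mem_enum !inE.
have [kP|kP] /= := boolP (k \in P); first by rewrite eK // orbF.
by have /negbTE-> : k \notin K by apply: contra kP => /KP.
Qed.

Lemma links_off_eq s f (P : {set 'I_n}) : {in ~: P, s =1 f} ->
  map (link s) (enum (nonright s :\: P)) = map (link f) (enum (nonright f :\: P)).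
Proof.
move=> e; have -> : nonright f :\: P = nonright s :\: P.
  apply/setP => k; rewrite !inE; have [//|kP] /= := boolP (k \in P).
  by rewrite e // inE.
apply/eq_in_map => k; rewrite mem_enum !inE => /andP[kP _].
by rewrite /link /mate e // inE.
Qed.

(** Both link lists share the part outside [P], which cancels. What remains is the interaction of
    the moved links with each common link and the weight among the moved links. *)
Lemma links_step s f (P : {set 'I_n}) (Ks Kf : seq 'I_n) :
    {in ~: P, s =1 f} ->
    uniq Ks -> {subset Ks <= P} -> {in P, forall k, (k \in Ks) = (k <= s k)} ->
    uniq Kf -> {subset Kf <= P} -> {in P, forall k, (k \in Kf) = (k <= f k)} ->
  let A := map (link s) Ks in let B := map (link f) Kf in
  [/\ (forall k, k \notin P -> k <= s k ->
         \sum_(a <- B) (weight a (link s k) + weight (link s k) a) =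
         \sum_(a <- A) (weight a (link s k) + weight (link s k) a)) ->
       link_weight B = (link_weight A).+1 ->
       link_weight (links f) = (link_weight (links s)).+1
    & forall a b, b < n ->
      arcs_in f a b + \sum_(g <- A) ((a <= g.1) && (g.2 <= b)) =
      arcs_in s a b + \sum_(g <- B) ((a <= g.1) && (g.2 <= b))].
Proof.
move=> e us ss es uf sf ef A B.
have ps := links_split us ss es; have := links_split uf sf ef.
rewrite -(links_off_eq e) => pf; split=> [eL eK | a b bn].
  rewrite (perm_link_weight ps) (perm_link_weight pf) !link_weight_cat -/A -/B eK.
  rewrite !addSn; congr (_ + _).+1; rewrite !big_map.
  by apply: eq_big_seq => k; rewrite mem_enum !inE => /andP[]; apply: eL.
rewrite !arcs_inE // (perm_big _ ps) (perm_big _ pf) !big_cat /= addnAC [RHS]addnAC.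
by congr (_ + _); rewrite addnC.
Qed.

Lemma conj_tpermE s u v k : (s ^ tperm u v)%g k = tperm u v (s (tperm u v k)).
Proof. by rewrite conjgE !permM tpermV. Qed.

Ltac decide_leq :=
  repeat match goal with |- context [leq ?a ?b] =>
    first [ have -> : leq a b = true by lia | have -> : leq a b = false by lia ] end.

(** A finite check over the positions of [p] and [q] relative to the four ends. The excluded links
    lie between the two nested ones; right ends coincide only at infinity. *)
Lemma weight_swap_left x i j c p q : x < i -> i < j -> j < c -> c <= n ->
  p < q -> q <= n -> p < n ->
  p <> x -> p <> i -> p <> j -> p <> c ->
  q <> x -> q <> i -> q <> j -> (q = c -> q = n) ->
  ~ (x < p /\ p < i /\ j < q /\ q <= c) ->
  let W a := weight a (p, q) + weight (p, q) a in
  W (x, j) + W (i, c) = W (x, c) + W (i, j).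
Proof.
move=> xi ij jc cn pq qn pn px pi pj pc qx qi qj hq hb /=.
have jn : j < n by lia.
rewrite /weight /= jn /=.
have [E1|[E1|[E1|[E1|E1]]]] :
  p < x \/ (x < p /\ p < i) \/ (i < p /\ p < j) \/ (j < p /\ p < c) \/ c < p by lia.
all: have [E2|[E2|[E2|[E2|[E2|E2]]]]] :
  q < x \/ (x < q /\ q < i) \/ (i < q /\ q < j) \/ (j < q /\ q < c) \/ q = c \/ c < q by lia.
all: try (exfalso; lia).
all: case: (ltnP q n) => ?; case: (ltnP c n) => ?.
all: try (exfalso; lia).
all: by decide_leq.
Qed.

Definition inle t s := forall a b, b < n -> arcs_in t a b <= arcs_in s a b.

Definition steps_down s t := exists f : 'S_n,
  [/\ forall k, f (f k) = k, inle t f, inle f s &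
      link_weight (links f) = (link_weight (links s)).+1].

Lemma conj_tperm_invol s u v : (forall k, s (s k) = k) ->
  forall k, (s ^ tperm u v)%g ((s ^ tperm u v)%g k) = k.
Proof. by move=> si k; rewrite !conj_tpermE tpermK si tpermK. Qed.

Ltac ordneq := rewrite -val_eqE; apply/eqP => /= ?; lia.

Lemma mate_cases s (k : 'I_n) : k <= s k ->
  (s k = k /\ mate s k = n) \/ (k < s k /\ mate s k = s k).
Proof.
rewrite /mate; case: (ltngtP k (s k)) => // h _; first by right.
by left; split => //; apply/val_inj.
Qed.

Lemma mate_range s (k : 'I_n) : k < mate s k <= n.
Proof. by rewrite /mate; case: ifP => [-> /=|_]; [apply: ltnW | rewrite ltn_ord leqnn]. Qed.

Lemma mate_neq s (k y : 'I_n) : (forall k, s (s k) = k) -> k <= s k -> k <> s y ->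
  mate s k <> y.
Proof.
move=> si /mate_cases[[_ ->] | [_ ->]] h e; first by have := ltn_ord y; lia.
by apply: h; rewrite -(val_inj e) si.
Qed.

(* The nested links (x, c), (i, j) become (x, j), (i, c); when [x] is fixed
   this moves the left end of the arc (i, j) to x. *)
Lemma steps_down_swap_left s t (x i : 'I_n) : (forall k, s (s k) = k) -> inle t s ->
  x < i -> i < s i -> s i < mate s x -> x <= s x ->
  (forall a b, x < a -> a <= i -> s i <= b -> b < mate s x -> b < n ->
     arcs_in t a b < arcs_in s a b) ->
  (forall p : 'I_n, x < p -> p < i -> p <= s p ->
     s i < mate s p -> mate s p <= mate s x -> False) ->
  steps_down s t.
Proof.
move=> si ts xi iI jc xx pos empty; set f := (s ^ tperm x i)%g.
have fK : forall k, f (f k) = k by apply: conj_tperm_invol.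
have nxi : x != i by ordneq.
have fx : f x = s i by rewrite conj_tpermE tpermL tpermD //; ordneq.
have sxE := mate_cases xx.
have fi : f i = if s x == x then i else s x.
  rewrite conj_tpermE tpermR; have [->|sx] := eqVneq (s x) x; first by rewrite tpermL.
  by rewrite tpermD //; [rewrite eq_sym | case: sxE => -[]; first move/eqP; [rewrite (negbTE sx) | move=> *; ordneq]].
have fj : f (s i) = x by rewrite -fx fK.
have fsx : f (s x) = if s x == x then s i else i.
  by have [->|sx] := eqVneq (s x) x; [| rewrite -[RHS]fK fi (negbTE sx)].
pose P := [set x; i; s i; s x].
have fP : {in ~: P, s =1 f}.
  move=> k; rewrite !inE !negb_or -!andbA => /and4P[kx ki ksi ksx].
  rewrite conj_tpermE (tpermD (z := k)) 1?eq_sym // tpermD //.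
  - by apply: contra ksx => /eqP ->; rewrite si.
  - by apply: contra ksi => /eqP ->; rewrite si.
have mi : mate s i = s i by rewrite /mate iI.
have mfx : mate f x = s i by rewrite /mate fx (ltn_trans xi iI).
have mfi : mate f i = mate s x.
  rewrite /mate fi; case: sxE => -[e e']; first by rewrite e eqxx ltnn ltnn.
  have -> : (s x == x) = false by apply/negbTE; ordneq.
  by rewrite e; case: ltnP => //; lia.
have [] := @links_step s f P [:: x; i] [:: x; i] fP.
- by rewrite /= inE nxi.
- by move=> k; rewrite !inE => /orP[] /eqP ->; rewrite eqxx ?orbT.
- move=> k; rewrite !inE => /orP[/orP[/orP[]|]|] /eqP ->; rewrite ?si -!val_eqE /=; try lia.
  by case: sxE => -[]; [move=> ->|]; lia.
- by rewrite /= inE nxi.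
- by move=> k; rewrite !inE => /orP[] /eqP ->; rewrite eqxx ?orbT.
- move=> k; rewrite !inE => /orP[/orP[/orP[]|]|] /eqP ->; rewrite ?fx ?fj ?fi ?fsx -!val_eqE /=; try lia.
  + by case: sxE => -[]; [move=> ->|]; case: ifP; lia.
  + by case: sxE => -[]; [move=> ->|]; case: ifP; lia.
rewrite /= {1 2 3 4 5 6}/link mfx mfi mi.
have /andP[_ cn] := mate_range s x; have jn := ltn_ord (s i).
set c := mate s x in jc pos empty sxE cn *.
move=> W R; exists f; split=> //.
(* Arcs are lost only in windows with [x < a <= i] and [s i <= b < mate s x], where [pos] leaves
   room. *)
- move=> a b bn; have := R a b bn; have := ts a b bn; have := pos a b.
  rewrite !big_cons !big_nil /=; lia.
- move=> a b bn; have := R a b bn.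
  rewrite !big_cons !big_nil /=; lia.
- apply: W; last first.
    rewrite /link_weight !big_cons !big_nil /weight /=; case: (ltnP c n) => ?; decide_leq; by [].
  move=> k; rewrite !inE !negb_or -!andbA -!val_eqE /= => /and4P[kx ki ksi ksx] kk.
  rewrite !big_cons !big_nil !addn0.
  have /andP[k1 k2] := mate_range s k.
  have kn := ltn_ord k.
  have qx : mate s k <> x by apply: mate_neq => // e; rewrite e eqxx in ksx.
  have qi : mate s k <> i by apply: mate_neq => // e; rewrite e eqxx in ksi.
  have qj : mate s k <> s i by apply: mate_neq => // e; rewrite e si eqxx in ki.
  have qc : mate s k = c -> mate s k = n.
    rewrite /c; case: sxE => -[_ e]; first by rewrite [mate s x]e.
    rewrite [mate s x]e => h; exfalso; move: h; apply: mate_neq => // h.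
    by rewrite h si eqxx in kx.
  apply: weight_swap_left => //; [exact/eqP | exact/eqP | exact/eqP | |].
    by move: ksx; case: sxE => -[_ ->]; lia.
  by move=> [h1 [h2 [h3 h4]]]; apply: (empty k).
Qed.

Lemma weight_swap_right i j v c p q : i < j -> j < v -> v < c -> c <= n ->
  p < q -> q <= n -> p < n ->
  p <> i -> p <> j -> p <> v -> p <> c ->
  q <> i -> q <> j -> q <> v -> (q = c -> q = n) ->
  ~ (j < p /\ p < v /\ c <= q) -> ~ (j < q /\ q < v /\ p < i) ->
  let W a := weight a (p, q) + weight (p, q) a in
  W (i, v) + W (j, c) = W (i, j) + W (v, c).
Proof.
move=> ij jv vc cn pq qn pn pi pj pv pc qi qj qv hq hb hb' /=.
have jn : j < n by lia.
have vn : v < n by lia.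
rewrite /weight /= jn vn /=.
have [E1|[E1|[E1|[E1|E1]]]] :
  p < i \/ (i < p /\ p < j) \/ (j < p /\ p < v) \/ (v < p /\ p < c) \/ c < p by lia.
all: have [E2|[E2|[E2|[E2|[E2|E2]]]]] :
  q < i \/ (i < q /\ q < j) \/ (j < q /\ q < v) \/ (v < q /\ q < c) \/ q = c \/ c < q by lia.
all: try (exfalso; lia).
all: case: (ltnP q n) => ?; case: (ltnP c n) => ?.
all: try (exfalso; lia).
all: by decide_leq.
Qed.

Lemma weight_cut i j p q : i < j -> j < n -> p < q -> q <= n -> p < n ->
  p <> i -> p <> j -> q <> i -> q <> j ->
  ~ (p < i /\ j < q) -> (q = n -> i < p /\ p < j) ->
  let W a := weight a (p, q) + weight (p, q) a in
  W (i, n) + W (j, n) = W (i, j).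
Proof.
move=> ij jn pq qn pn pi pj qi qj hb hb' /=.
rewrite /weight /= jn ltnn /=.
have [E1|[E1|E1]] : p < i \/ (i < p /\ p < j) \/ j < p by lia.
all: have [E2|[E2|E2]] : q < i \/ (i < q /\ q < j) \/ j < q by lia.
all: try (exfalso; lia).
all: case: (ltnP q n) => ?.
all: try (exfalso; lia).
all: by decide_leq.
Qed.

(* The disjoint links (i, j), (v, c) become (i, v), (j, c); when [v] is fixed
   this moves the right end of the arc (i, j) to v. *)
Lemma steps_down_swap_right s t (i v : 'I_n) : (forall k, s (s k) = k) -> inle t s ->
  i < s i -> s i < v -> v <= s v ->
  (forall a b, a <= i -> s i <= b -> b < v -> arcs_in t a b < arcs_in s a b) ->
  (forall a b, s i < a -> a <= v -> mate s v <= b -> b < n ->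
     arcs_in t a b < arcs_in s a b) ->
  (forall p : 'I_n, s i < p -> p < v -> p <= s p -> mate s v <= mate s p -> False) ->
  (forall q : 'I_n, s i < q -> q < v -> s q < i -> False) ->
  steps_down s t.
Proof.
move=> si ts iI jv vv pos pos' empty empty'; set f := (s ^ tperm (s i) v)%g.
have fK : forall k, f (f k) = k by apply: conj_tperm_invol.
have nij : i != s i by ordneq.
have niv : i != v by ordneq.
have fi : f i = v by rewrite conj_tpermE (tpermD (z := i)) ?tpermL // eq_sym.
have svE := mate_cases vv.
have fv : f v = i by rewrite -fi fK.
have fj : f (s i) = if s v == v then s i else s v.
  rewrite conj_tpermE tpermL; have [->|sv] := eqVneq (s v) v; first by rewrite tpermR.
  by rewrite tpermD //; [case: svE => -[]; [move/eqP; rewrite (negbTE sv) | move=> *; ordneq] | rewrite eq_sym].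
have fsv : f (s v) = if s v == v then i else s i.
  by have [->|sv] := eqVneq (s v) v; [| rewrite -[RHS]fK fj (negbTE sv)].
pose P := [set i; s i; v; s v].
have fP : {in ~: P, s =1 f}.
  move=> k; rewrite !inE !negb_or -!andbA => /and4P[ki ksi kv ksv].
  rewrite conj_tpermE (tpermD (z := k)) 1?eq_sym // tpermD //.
  - by apply: contra ki => /eqP /(congr1 s); rewrite !si => ->.
  - by apply: contra ksv => /eqP ->; rewrite si.
have mi : mate s i = s i by rewrite /mate iI.
have mfi : mate f i = v by rewrite /mate fi (ltn_trans iI jv).
have mfj : mate f (s i) = mate s v.
  rewrite /mate fj; case: svE => -[e e']; first by rewrite e eqxx ltnn ltnn.
  have -> : (s v == v) = false by apply/negbTE; ordneq.
  by rewrite e; case: ltnP => //; lia.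
have [] := @links_step s f P [:: i; v] [:: i; s i] fP.
- by rewrite /= inE niv.
- by move=> k; rewrite !inE => /orP[] /eqP ->; rewrite eqxx ?orbT.
- move=> k; rewrite !inE => /orP[/orP[/orP[]|]|] /eqP ->; rewrite ?si -!val_eqE /=; try lia.
- by rewrite /= inE nij.
- by move=> k; rewrite !inE => /orP[] /eqP ->; rewrite eqxx ?orbT.
- move=> k; rewrite !inE => /orP[/orP[/orP[]|]|] /eqP ->; rewrite ?fi ?fj ?fv ?fsv -!val_eqE /=; try lia.
  + by case: svE => -[]; [move=> ->|]; case: ifP; lia.
  + by case: svE => -[]; [move=> ->|]; case: ifP; lia.
rewrite /= {1 2 3 4 5 6}/link mfi mfj mi.
have /andP[vc cn] := mate_range s v; have jn := ltn_ord (s i).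
set c := mate s v in pos' empty svE cn vc *.
move=> W R; exists f; split=> //.
(* Arcs are lost in two kinds of windows: those containing [(i, s i)] but ending before [v], and
   those starting after [s i] and containing the link of [v]. *)
- move=> a b bn; have := R a b bn; have := ts a b bn; have := pos a b; have := pos' a b.
  rewrite !big_cons !big_nil /=; lia.
- move=> a b bn; have := R a b bn.
  rewrite !big_cons !big_nil /=; lia.
- have vn := ltn_ord v; apply: W; last first.
    rewrite /link_weight !big_cons !big_nil /weight /=; case: (ltnP c n) => ?; decide_leq; by [].
  move=> k; rewrite !inE !negb_or -!andbA -!val_eqE /= => /and4P[ki ksi kv ksv] kk.
  rewrite !big_cons !big_nil !addn0.
  have /andP[k1 k2] := mate_range s k.
  have kn := ltn_ord k.
  have qi : mate s k <> i by apply: mate_neq => // e; rewrite e eqxx in ksi.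
  have qj : mate s k <> s i by apply: mate_neq => // e; rewrite e si eqxx in ki.
  have qv : mate s k <> v by apply: mate_neq => // e; rewrite e eqxx in ksv.
  have qc : mate s k = c -> mate s k = n.
    rewrite /c; case: svE => -[_ e]; first by rewrite [mate s v]e.
    rewrite [mate s v]e => h; exfalso; move: h; apply: mate_neq => // h.
    by rewrite h si eqxx in kv.
  apply: weight_swap_right => //; [exact/eqP | exact/eqP | exact/eqP | | |].
  + by move: ksv; case: svE => -[_ ->]; lia.
  + by move=> [h1 [h2 h3]]; apply: (empty k).
  + move=> [h1 [h2 h3]]; have [[_ e]|[_ e]] := mate_cases kk; first by lia.
    by apply: (empty' (s k)); rewrite ?si //; lia.
Qed.

Lemma steps_down_cut s t (i : 'I_n) : (forall k, s (s k) = k) -> inle t s ->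
  i < s i ->
  (forall a b, a <= i -> s i <= b -> b < n -> arcs_in t a b < arcs_in s a b) ->
  (forall p : 'I_n, p < i -> p <= s p -> s i < mate s p -> False) ->
  (forall p : 'I_n, s i < p -> s p = p -> False) ->
  steps_down s t.
Proof.
move=> si ts iI pos empty empty'; set f := (tperm i (s i) * s)%g.
have nij : i != s i by ordneq.
have fi : f i = i by rewrite permM tpermL si.
have fj : f (s i) = s i by rewrite permM tpermR.
pose P := [set i; s i].
have fP : {in ~: P, s =1 f}.
  move=> k; rewrite !inE !negb_or => /andP[ki ksi].
  by rewrite permM tpermD // eq_sym.
have fK : forall k, f (f k) = k.
  move=> k; have [->|ki] := eqVneq k i; first by rewrite !fi.
  have [->|kj] := eqVneq k (s i); first by rewrite !fj.
  rewrite -(fP k) ?inE ?negb_or ?ki //.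
  rewrite -(fP (s k)) ?inE ?negb_or ?si //; apply/andP; split.
    by apply: contra kj => /eqP <-; rewrite si.
  by apply: contra ki => /eqP /(congr1 s); rewrite !si => ->.
have mi : mate s i = s i by rewrite /mate iI.
have mfi : mate f i = n by rewrite /mate fi ltnn.
have mfj : mate f (s i) = n by rewrite /mate fj ltnn.
have [] := @links_step s f P [:: i] [:: i; s i] fP.
- by [].
- by move=> k; rewrite !inE => /eqP ->; rewrite eqxx.
- by move=> k; rewrite !inE => /orP[] /eqP ->; rewrite ?si -!val_eqE /=; lia.
- by rewrite /= inE nij.
- by move=> k; rewrite !inE.
- by move=> k; rewrite !inE => /orP[] /eqP ->; rewrite ?fi ?fj leqnn eqxx ?orbT.
rewrite /= {1 2 3 4 5 6}/link mfi mfj mi.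
have jn := ltn_ord (s i).
move=> W R; exists f; split=> //.
- move=> a b bn; have := R a b bn; have := ts a b bn; have := pos a b.
  rewrite !big_cons !big_nil /=; lia.
- move=> a b bn; have := R a b bn.
  rewrite !big_cons !big_nil /=; lia.
- apply: W; last first.
    rewrite /link_weight !big_cons !big_nil /weight /=; decide_leq; by [].
  move=> k; rewrite !inE !negb_or -!val_eqE /= => /andP[ki ksi] kk.
  rewrite !big_cons !big_nil !addn0.
  have /andP[k1 k2] := mate_range s k.
  have kn := ltn_ord k.
  have qi : mate s k <> i by apply: mate_neq => // e; rewrite e eqxx in ksi.
  have qj : mate s k <> s i by apply: mate_neq => // e; rewrite e si eqxx in ki.
  apply: weight_cut => //; [exact/eqP | exact/eqP | |].
  + by move=> [h1 h2]; apply: (empty k).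
  + move=> e; have [[h _]|[_ e']] := mate_cases kk; last first.
      by exfalso; have := ltn_ord (s k); lia.
    case: (ltnP i k) => h1; last by exfalso; apply: (empty k) => //; [move/eqP: ki; lia | lia].
    by split=> //; case: (ltnP k (s i)) => h2 //; exfalso; apply: (empty' k) => //; move/eqP: ksi; lia.
Qed.

End Links.

(** * Existence of a move that stays above a given smaller involution *)

Section Descent.
Variable n : nat.
Implicit Types s f t : 'S_n.

Lemma card_pred_sum (T : finType) (P : pred T) : #|[set k | P k]| = \sum_k P k.
Proof. by rewrite -sum1_card big_mkcond; apply: eq_bigr => k _; rewrite inE; case: (P k). Qed.

Lemma card_predD (T : finType) (P Q1 Q2 : pred T) : (forall k, P k = Q1 k + Q2 k :> nat) ->
  #|[set k | P k]| = #|[set k | Q1 k]| + #|[set k | Q2 k]|.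
Proof. by move=> e; rewrite !card_pred_sum -big_split /=; apply: eq_bigr. Qed.

Lemma exists_lexmin (T : finType) (P : pred T) (F G : T -> nat) x0 : P x0 ->
  exists2 x, P x & forall p, P p -> F x < F p \/ F x = F p /\ G x <= G p.
Proof.
move=> P0; case: (arg_minnP F P0) => y Py miny.
have Py' : P y && (F y == F y) by rewrite Py eqxx.
case: (@arg_minnP _ _ (fun x => P x && (F x == F y)) G Py') => x /andP[Px /eqP Fx] minx.
exists x => // p Pp; have := miny p Pp; rewrite leq_eqVlt => /orP[/eqP e|]; last by rewrite Fx; left.
by right; rewrite Fx; split=> //; apply: minx; rewrite Pp -e eqxx.
Qed.

Lemma arcs_in_ge s a b : n <= a -> arcs_in s a b = 0.
Proof.
move=> na; apply/eqP; rewrite cards_eq0; apply/eqP/setP => k; rewrite !inE.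
by have := ltn_ord k; lia.
Qed.

Lemma arcs_in0 s a : arcs_in s a 0 = 0.
Proof.
by apply/eqP; rewrite cards_eq0; apply/eqP/setP => k; rewrite !inE; lia.
Qed.

Definition arcs_from s (a a' b : nat) : nat :=
  #|[set k : 'I_n | [&& a <= k, k < a', k < s k & s k <= b]]|.

Lemma arcs_in_rows s a a' b : a <= a' ->
  arcs_in s a b = arcs_in s a' b + arcs_from s a a' b.
Proof. by move=> aa; apply: card_predD => k; lia. Qed.

Lemma leq_arcs_from s a a' b b' : b <= b' -> arcs_from s a a' b <= arcs_from s a a' b'.
Proof. by move=> bb; apply/subset_leq_card/fintype.subsetP => k; rewrite !inE; lia. Qed.

Section Invol.
Variable s : 'S_n.
Hypothesis sK : forall k, s (s k) = k.

Lemma arcs_inC a b :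
  arcs_in s a b = #|[set q : 'I_n | [&& s q < q, a <= s q & q <= b]]|.
Proof.
rewrite -[RHS](card_preimset _ (@perm_inj _ s)); congr #|pred_of_set _|.
by apply/setP => k; rewrite !inE sK andbCA.
Qed.

Lemma arcs_in_cols a b c : b <= c ->
  arcs_in s a c =
  arcs_in s a b + #|[set q : 'I_n | [&& b < q, q <= c, s q < q & a <= s q]]|.
Proof. by move=> bc; rewrite !arcs_inC; apply: card_predD => k; lia. Qed.

Lemma arcs_in_col a (y : 'I_n) :
  arcs_in s a y = arcs_in s a y.-1 + ((s y < y) && (a <= s y)).
Proof.
rewrite (@arcs_in_cols a y.-1 y) ?leq_pred //; congr (_ + _).
rewrite (cardsD1 y) inE (_ : _ :\ y = finset.set0) ?cards0 ?addn0; last first.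
  apply/setP => q; rewrite !inE -val_eqE /=; lia.
by rewrite leqnn /=; lia.
Qed.

End Invol.

(** The rank increments in column [y] reveal the left end of the arc ending there; the rows [s y]
    and [t y] give the two inequalities. *)
Lemma agree_on_cols s t (j : nat) :
  (forall k, s (s k) = k) -> (forall k, t (t k) = k) ->
  (forall a b, b < j -> arcs_in t a b = arcs_in s a b) ->
  forall y : 'I_n, y < j -> s y < y -> t y = s y.
Proof.
move=> sK tK e y yj sy; apply/val_inj/eqP.
have ey a : arcs_in t a y.-1 = arcs_in s a y.-1 by apply: e; lia.
have := e (s y) y yj; have := e (t y) y yj.
by rewrite !arcs_in_col // !ey /=; lia.
Qed.

Lemma arcs_in_inj s t :
  (forall k, s (s k) = k) -> (forall k, t (t k) = k) ->
  (forall a b, b < n -> arcs_in t a b = arcs_in s a b) -> t = s.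
Proof.
move=> sK tK e; apply/permP => k.
have st := agree_on_cols sK tK e.
have ts := agree_on_cols tK sK (fun a b h => esym (e a b h)).
case: (ltngtP (s k) k) => h; first exact: st.
  by rewrite -{1}[k]sK -(st (s k)) ?sK // tK.
have sk : s k = k by apply: val_inj.
case: (ltngtP (t k) k) => h'; first by rewrite -ts.
  by have := ts (t k) (ltn_ord _); rewrite tK => /(_ h') /(congr1 s); rewrite sK.
by rewrite sk; apply: val_inj.
Qed.

(* [j] is the first column where the ranks differ, and the arc [(i, j)] of [s] is
   the one being moved; [y] is the first column after it where some rank at
   height at most [i] has caught up.  If no row allows a move to the left, then
   up to column [y] the arc can be moved to the right: onto the non-right end
   [v] whose mate is largest.  The ranks to the right of [mate v] leave room for
   this because [t], unlike [s], has lost a left end between [j] and [y]. *)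
Lemma descent s t : (forall k, s (s k) = k) -> (forall k, t (t k) = k) ->
  inle t s -> t != s -> steps_down s t.
Proof.
move=> sK tK ts nst.
pose differ b := (b < n) && [exists a : 'I_n, arcs_in t a b != arcs_in s a b].
have /ex_minnP[j0 /andP[j0n /existsP[a0 ne0]] minj] : exists b, differ b.
  case: (pselect (exists b, differ b)) => // nd; case/negP: nst; apply/eqP.
  apply: arcs_in_inj => // a b bn; case: (ltnP a n) => an; last by rewrite !arcs_in_ge.
  apply/eqP; apply: contraT => ne; case: nd; exists b; rewrite /differ bn /=.
  by apply/existsP; exists (Ordinal an).
have [j ej] : exists j : 'I_n, nat_of_ord j = j0 by exists (Ordinal j0n).
subst j0; set i := s j.
have sij : s i = j by rewrite sK.
have eqj a b : b < j -> arcs_in t a b = arcs_in s a b.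
  move=> bj; apply/eqP; apply: contraT => ne; have := minj b; rewrite leqNgt bj /differ.
  case: (ltnP a n) => an; last by rewrite !arcs_in_ge ?eqxx // in ne.
  have -> : b < n by apply: ltn_trans bj _.
  by case: existsP => [_ /(_ isT) // | []]; exists (Ordinal an).
have tcol a := arcs_in_col tK a j.
have scol a := arcs_in_col sK a j.
have colj a : arcs_in t a j.-1 = arcs_in s a j.-1.
  by case: (posnP j) => [-> | jp]; [rewrite !arcs_in0 | apply: eqj; lia].
have lej a := ts a j j0n.
(* Before column [j] the ranks agree, so the defect in row [a0] comes from an arc of [s] ending at
   [j]. *)
have /andP[ij aj0] : (i < j) && (a0 <= i).
  by move: ne0 (lej a0); rewrite tcol scol colj /i; lia.
have tji : t j < j -> t j < i.
  by move: ne0 (lej a0) (lej (t j)); rewrite !tcol !scol !colj -/i ij; lia.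
have posj a : a <= i -> (t j < j -> t j < a) -> arcs_in t a j < arcs_in s a j.
  by rewrite tcol scol colj -/i ij; lia.
(* [zero] holds at [n] by convention, so [y = n] encodes that no row up to [i] catches up. *)
pose zero b := (j <= b) &&
  ((b == n) || [exists a : 'I_n, (a <= i) && (arcs_in t a b == arcs_in s a b)]).
have /ex_minnP[y /andP[jy zy] miny] : exists b, zero b.
  by exists n; rewrite /zero eqxx (ltnW j0n).
have yn : y <= n by apply: miny; rewrite /zero eqxx (ltnW j0n).
have posy a b : a <= i -> j <= b -> b < y -> arcs_in t a b < arcs_in s a b.
  move=> ai jb yb; have bn : b < n by lia.
  rewrite ltn_neqAle ts // andbT; apply: contraTN yb => e; rewrite -leqNgt.
  have an : a < n by have := ltn_ord i; lia.
  by apply: miny; rewrite /zero jb /=; apply/orP; right; apply/existsP; exists (Ordinal an); rewrite ai.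
have i_lt_si : i < s i by rewrite sij.
have mateL (k : 'I_n) : k < s k -> mate s k = s k by rewrite /mate => ->.
case: (ltngtP y n) yn => // [{}yn | yE] _; last first.
  (* All rows up to [i] have room from column [j] on, so the three moves are tried in turn. The
     enclosing link with smallest right end, and then largest left end, has no link between it and
     the arc. *)
  pose P (x : 'I_n) := [&& x < i, x <= s x & j < mate s x].
  case: (pickP P) => [x1 Px1 | noP].
    have [x /and3P[xi xx jx] minx] := exists_lexmin (mate s) (fun x => n - x) Px1.
    apply: (@steps_down_swap_left n s t x i) => //; rewrite ?sij //.
      by move=> a b _ ai jb _ bn; apply: posy; rewrite // yE.
    move=> p xp pi pp jp px; have Pp : P p by rewrite /P pi pp jp.
    by have := ltn_ord p; have := minx p Pp; lia.
  pose Q (v : 'I_n) := (j < v) && (s v == v).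
  case: (pickP Q) => [v1 Qv1 | noQ].
    have [v /andP[jv /eqP sv] minv] := exists_lexmin (fun v => val v) (fun v => val v) Qv1.
    have mv : mate s v = n by rewrite /mate sv ltnn.
    apply: (@steps_down_swap_right n s t i v); rewrite ?sij ?sv ?mv //.
    - by move=> a b ai jb bv; apply: posy => //; rewrite yE (ltn_trans bv).
    - by move=> a b _ _ nb bn; lia.
    - move=> p jp pv pp np; have [[sp _]|[_ e]] := mate_cases pp.
        by have := minv p; rewrite /Q jp sp eqxx => /(_ isT) /=; lia.
      by have := ltn_ord (s p); lia.
    - move=> q jq qv sq; have := noP (s q).
      by rewrite /P sq sK mateL ?sK; lia.
  apply: (@steps_down_cut n s t i); rewrite ?sij //.
  - by move=> a b ai jb bn; apply: posy; rewrite // yE.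
  - by move=> p pi pp jp; have := noP p; rewrite /P pi pp jp.
  - by move=> p jp sp; have := noQ p; rewrite /Q jp sp eqxx.
move: zy; rewrite (ltn_eqF yn) /= => /existsP[a1 /andP[a1i a1y]].
(* [a1] becomes the largest row up to [i] that has caught up in column [y]. *)
pose Z (a : 'I_n) := (a <= i) && (arcs_in t a y == arcs_in s a y).
have Za1 : Z a1 by rewrite /Z a1i.
case: (arg_maxnP (fun a : 'I_n => val a) Za1) => {a1 a1i a1y Za1} a1 /andP[a1i /eqP a1y] maxa.
have pos1 a : a1 < a -> a <= i -> arcs_in t a y < arcs_in s a y.
  move=> a1a ai; rewrite ltn_neqAle ts // andbT; apply: contraTN a1a => e.
  have an : a < n by have := ltn_ord i; lia.
  by rewrite -leqNgt; apply: (maxa (Ordinal an)); rewrite /Z ai.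
have from_eq a : a1 <= a -> arcs_from t a1 a j.-1 = arcs_from s a1 a j.-1.
  by move=> h; have := arcs_in_rows t j.-1 h; have := arcs_in_rows s j.-1 h; rewrite !colj; lia.
pose P (x : 'I_n) := [&& a1 <= x, x < i, x <= s x & j < mate s x].
have ssi (k : 'I_n) : k < i -> s k != j by move=> ki; apply/eqP => e; move: ki; rewrite /i -e sK ltnn.
case: (pickP P) => [x1 Px1 | noP].
  have [x /and4P[a1x xi xx jx] minx] := exists_lexmin (mate s) (fun x => n - x) Px1.
  apply: (@steps_down_swap_left n s t x i) => //; rewrite ?sij //; last first.
    move=> p xp pi pp jp px; have Pp : P p by rewrite /P pi pp jp (leq_trans a1x (ltnW xp)).
    by have := ltn_ord p; have := minx p Pp; lia.
  move=> a b xa ai jb bx bn; case: (ltnP b y) => yb; first exact: posy.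
  have a1a : a1 <= a by lia.
  (* By minimality of [mate s x], no arc of [s] starting in [[a1, a)] ends between [j] and
     [mate s x]. In column [y], [t] already has more arcs from these rows than [s], so row [a] of
     [t] stays behind up to column [b]. *)
  have low c : c < mate s x -> arcs_from s a1 a c <= arcs_from s a1 a j.-1.
    move=> cx; apply/subset_leq_card/fintype.subsetP => k; rewrite !inE => /and4P[k1 k2 k3 k4].
    rewrite k1 k2 k3 /=; case: (ltngtP (s k) j) => h; first by lia.
      have := minx k; rewrite /P k1 (ltnW k3) mateL // h (leq_trans k2 ai) => /(_ isT); lia.
    by case/eqP: (ssi k (leq_trans k2 ai)); apply: val_inj.
  have := low b bx; have := low y (leq_ltn_trans yb bx).
  have := from_eq a a1a; have := leq_arcs_from t a1 a yb.
  have := arcs_in_rows t y a1a; have := arcs_in_rows s y a1a.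
  have := arcs_in_rows t b a1a; have := arcs_in_rows s b a1a.
  have := ts a1 b bn; have := pos1 a; have := leq_arcs_from s a1 a yb.
  have := @leq_arcs_from s a1 a j.-1 y; lia.
(* No link of [s] starting in [[a1, i)] encloses the arc, so [s] sends these positions below [j],
   where [s] and [t] agree. Hence row [i] itself has caught up in column [y]. *)
have fromE : arcs_from t a1 i y = arcs_from s a1 i y.
  have touched (k : 'I_n) : a1 <= k -> k < i -> s k < j.
    move=> ak ki; have sjk := ssi k ki; rewrite ltn_neqAle sjk leqNgt.
    apply/negP => jk; have := noP k; rewrite /P ak ki mateL; lia.
  apply: eq_card => k; rewrite !inE; case: (leqP a1 k) => //= ak.
  case: (ltnP k i) => //= ki; have sj := touched k ak ki.
  suff -> : t k = s k by [].
  case: (leqP k (s k)) => h; last first.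
    by apply: (agree_on_cols sK tK eqj) => //; have := ltn_ord i; lia.
  have [[sk mk]|[kk _]] := mate_cases h.
    by have := noP k; rewrite /P ak ki mk h ltn_ord.
  have := agree_on_cols sK tK eqj sj; rewrite sK => /(_ kk) /(congr1 t).
  by rewrite tK.
have Eiy : arcs_in t i y = arcs_in s i y.
  have := arcs_in_rows t y a1i; have := arcs_in_rows s y a1i; lia.
have jy' : j < y.
  rewrite ltn_neqAle jy andbT; apply/eqP => e.
  by have := posj i (leqnn i) tji; rewrite e Eiy ltnn.
pose Y := Ordinal yn.
have posY : arcs_in t i y.-1 < arcs_in s i y.-1 by apply: posy; lia.
(* Row [i] catches up exactly in column [y], so there [t] gains an arc and [s] does not. *)
have [tY tiY sY] : [/\ t Y < Y, i <= t Y & s Y < Y -> s Y < i].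
  have := arcs_in_col tK i Y; have := arcs_in_col sK i Y; rewrite /= Eiy.
  by move=> h1 h2; split; lia.
(* An arc of [s] over [(i, j)] ending by column [y] needs room only in columns before [y]. *)
pose P1 (q : 'I_n) := [&& j < q, q <= y & s q < i].
case: (pickP P1) => [q1 Pq1 | noP1].
  have [q /and3P[jq qy sq] minq] := exists_lexmin (fun v => val v) (fun v => val v) Pq1.
  have ssq : s (s q) = q := sK q.
  have msq : mate s (s q) = q by rewrite mateL ?ssq; lia.
  apply: (@steps_down_swap_left n s t (s q) i); rewrite ?sij ?msq ?ssq //; first by lia.
    by move=> a b _ ai jb bq _; apply: posy => //; lia.
  move=> p xp pi pp jp pq; have [[_ e]|[p1 e]] := mate_cases pp; first by have := ltn_ord q; lia.
  have := minq (s p); rewrite /P1 sK -e jp (leq_trans pq qy) pi => /(_ isT) /= h.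
  have esp : s p = q by apply: val_inj => /=; lia.
  by move: xp; rewrite -esp sK ltnn.
pose P2 (v : 'I_n) := [&& j < v, v <= y & v <= s v].
have P2Y : P2 Y.
  rewrite /P2 jy' leqnn leqNgt /=; apply/negP => h.
  by have := noP1 Y; rewrite /P1 jy' leqnn (sY h).
have [v /and3P[jv vy vv] minv] := exists_lexmin (fun v => n - mate s v) (fun v => val v) P2Y.
have /andP[_ mvn] := mate_range s v.
apply: (@steps_down_swap_right n s t i v); rewrite ?sij //.
- by move=> a b ai jb bv; apply: posy => //; lia.
(* In [s], each position in [(j, y]] is a left end whose arc ends by [b], or a right end whose arc
   starts at or after [i]. Row [i] catches up between columns [a.-1] and [y], so [t] has more of the
   latter in [[a, y]] and therefore fewer of the former. *)
- move=> a b ja av cb bn.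
  have nofix (k : 'I_n) : j < k -> k <= y -> k < s k <= b \/ s k < k /\ i <= s k.
    move=> jk ky; case: (leqP k (s k)) => kk; last first.
      by right; split=> //; have := noP1 k; rewrite /P1 jk ky; lia.
    left; have Pk : P2 k by rewrite /P2 jk ky.
    have := minv k Pk; have := mate_cases kk; lia.
  have ay : a <= y.+1 by lia.
  have r1 := arcs_in_rows t b ay; have r2 := arcs_in_rows s b ay.
  have le1 := ts y.+1 b bn.
  have ay' : a.-1 <= y by lia.
  have c1 := arcs_in_cols tK i ay'; have c2 := arcs_in_cols sK i ay'.
  have lt1 : arcs_in t i a.-1 < arcs_in s i a.-1 by apply: posy; lia.
  have count_s : arcs_from s a y.+1 b +
      #|[set q : 'I_n | [&& a.-1 < q, q <= y, s q < q & i <= s q]]| =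
      #|[set q : 'I_n | a <= q <= y]|.
    symmetry; apply: card_predD => k; have := nofix k; lia.
  have count_t : arcs_from t a y.+1 b +
      #|[set q : 'I_n | [&& a.-1 < q, q <= y, t q < q & i <= t q]]| <=
      #|[set q : 'I_n | a <= q <= y]|.
    rewrite /arcs_from !card_pred_sum -big_split /=; apply: leq_sum => k _; lia.
  lia.
- move=> p jp pv pp cp; have := minv p; rewrite /P2 jp pp (leq_trans (ltnW pv) vy) => /(_ isT) /=.
  by have /andP[_ +] := mate_range s p; lia.
- by move=> q jq qv sq; have := noP1 q; rewrite /P1 jq sq; lia.
Qed.

End Descent.

(** * The weight as a rank function for the order *)

Section Grading.
Variable n : nat.
Implicit Types s f t : 'S_n.

(* Indices of the free coordinates of the centraliser of [N_s] in the upper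
   triangular matrices. *)
Definition stab_pairs s : {set 'I_n * 'I_n} :=
  [set pq : 'I_n * 'I_n | (pq.1 <= pq.2) && ((pq.1 <= s pq.1) && (s pq.2 <= pq.2)
     || [&& pq.1 < s pq.1, pq.2 < s pq.2 & s pq.1 <= s pq.2])].

Lemma card_stab_pairs s : (forall k, s (s k) = k) ->
  #|stab_pairs s| = link_weight n (links s).
Proof.
move=> sK.
transitivity (\sum_(p : 'I_n | p <= s p) \sum_(q : 'I_n | q <= s q) (p <= s q) +
   \sum_(p : 'I_n | p <= s p) \sum_(q : 'I_n | q <= s q)
      [&& p <= q, p < s p, q < s q & s p <= s q]).
  transitivity (\sum_p \sum_q ((p, q) \in stab_pairs s)).
    rewrite -sum1_card big_mkcond pair_bigA /=.
    by apply: eq_bigr => -[p q] _ /=; case: ifP.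
  rewrite -big_split /= [RHS]big_mkcond; apply: eq_bigr => p _ /=.
  case: (leqP p (s p)) => hp; last by rewrite big1 // => q _; rewrite inE /=; lia.
  (* Replacing [q] by [s q] exchanges non-right ends and non-left ends in the first term. *)
  rewrite [X in _ = X + _](reindex_onto s s) /=; last by move=> q _; exact: sK.
  rewrite [X in _ = X + _]big_mkcond [X in _ = _ + X]big_mkcond -big_split /=; apply: eq_bigr => q _ /=.
  rewrite inE /= !sK eqxx andbT; case: (leqP (s q) q); case: (leqP q (s q)); lia.
rewrite /link_weight /links big_map big_enum_cond /=.
under [RHS]eq_bigl do rewrite inE andbT.
rewrite -big_split; apply: eq_bigr => p pp /=.
rewrite -big_split big_map big_enum_cond /=.
under [RHS]eq_bigl do rewrite inE andbT.
apply: eq_bigr => q qq; rewrite /weight /link /=.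
have sqn := ltn_ord (s q); have spn := ltn_ord (s p).
have [[ep ->]|[ep ->]] := mate_cases pp; have [[eq ->]|[eq ->]] := mate_cases qq;
  rewrite ?ep ?eq ?ltnn ?sqn ?spn /=; rewrite ?andbF //; lia.
Qed.

Lemma link_weight_le s : (forall k, s (s k) = k) -> link_weight n (links s) <= n * n.
Proof.
by move=> sK; rewrite -card_stab_pairs // (leq_trans (max_card _)) // card_prod card_ord.
Qed.

(** Repeated descent leads from [s] to [t] by steps of weight one; it stops because weights are
    bounded by [n * n]. *)
Lemma link_weight_strict s t : (forall k, s (s k) = k) -> (forall k, t (t k) = k) ->
  inle t s -> t != s -> link_weight n (links s) < link_weight n (links t).
Proof.
move: {2}(n * n - link_weight n (links s)) (leqnn (n * n - link_weight n (links s))) => m.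
elim: m s => [|m IH] s hm sK tK ts nts.
  all: have [f [fK tf fs ef]] := descent sK tK ts nts.
  all: have fn := link_weight_le fK.
  by lia.
have [->|ntf] := eqVneq t f; first by rewrite ef.
by apply: (@ltn_trans (link_weight n (links f))); [rewrite ef | apply: IH => //; lia].
Qed.

(** For involutions [s] this is [gen_desc] ([gen_descP]), expressed through the weight. *)
Definition covers s t :=
  [/\ forall k, t (t k) = k, inle t s & link_weight n (links t) = (link_weight n (links s)).+1].

Lemma chain_exists s t : (forall k, s (s k) = k) -> (forall k, t (t k) = k) -> inle t s ->
  exists2 c, path (fun a b => `[< covers a b >]) s c & last s c = t.
Proof.
move: {2}(n * n - link_weight n (links s)) (leqnn (n * n - link_weight n (links s))) => m.
elim: m s => [|m IH] s hm sK tK ts; have [->|nts] := eqVneq t s; try by exists [::].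
  all: have [f [fK tf fs ef]] := descent sK tK ts nts.
  all: have fn := link_weight_le fK.
  by lia.
have [|c pc lc] := IH f _ fK tK tf; first by lia.
by exists (f :: c) => //=; rewrite pc andbT; apply/asboolP.
Qed.

End Grading.

Local Open Scope ring_scope.

(** * Algebraically independent functions on parametrised sets *)

Section AlgebraicDependence.
Variable F : fieldType.

Lemma msizeM_bound d (p q : {mpoly F[d]}) k l :
  (msize p <= k.+1)%N -> (msize q <= l.+1)%N -> (msize (p * q) <= (k + l).+1)%N.
Proof.
have [->|p0] := eqVneq p 0; first by rewrite mul0r msize0.
have [->|q0] := eqVneq q 0; first by rewrite mulr0 msize0.
rewrite msizeM // => hp hq.
have := leq_add hp hq; rewrite addSn addnS.
by case: (msize p + msize q)%N => //= m; rewrite ltnS.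
Qed.

Lemma msize_prod_bound d (I : Type) (r : seq I) (p : I -> {mpoly F[d]}) (k : I -> nat) :
  (forall i, msize (p i) <= (k i).+1)%N ->
  (msize (\prod_(i <- r) p i) <= (\sum_(i <- r) k i).+1)%N.
Proof.
move=> h; elim: r => [|i r IH]; first by rewrite !big_nil msize1.
by rewrite !big_cons msizeM_bound.
Qed.

(* The monomials in [h] with exponents below [D] outnumber the monomials that
   can occur in their expansions once [D] is large. *)
Lemma alg_dependent d e (h : e.-tuple {mpoly F[d]}) : (d < e)%N ->
  exists2 P : {mpoly F[e]}, P != 0 & comp_mpoly h P = 0.
Proof.
move=> de; pose m := \max_(i < e) msize (tnth h i).
(* Expansions have degree below $B$, and $B\le D(e(m+1)+1)$ with $D>(e(m+1)+1)^d$ gives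
   $B^d<D^{d+1}\le D^e$. *)
pose D := ((e * m.+1).+1 ^ d).+1; pose B := (e * D * m.+1).+1.
pose expo (f : {ffun 'I_e -> 'I_D}) : 'X_{1..e} := [multinom (f i : nat) | i < e].
pose expo' (f : {ffun 'I_d -> 'I_B}) : 'X_{1..d} := [multinom (f i : nat) | i < d].
pose M : 'M[F]_(#|{ffun 'I_e -> 'I_D}|, #|{ffun 'I_d -> 'I_B}|) :=
  \matrix_(a, b) (comp_mpoly h 'X_[expo (enum_val a)])@_(expo' (enum_val b)).
have rkM : (\rank M < #|{ffun 'I_e -> 'I_D}|)%N.
  apply: leq_ltn_trans (rank_leq_col _) _; rewrite !card_ffun !card_ord.
  apply: (@leq_ltn_trans ((D * (e * m.+1).+1) ^ d)%N).
    have lexp x y k : (x <= y -> x ^ k <= y ^ k)%N by case: k => // k; rewrite leq_exp2r.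
    by apply: lexp; rewrite /B [X in (_ <= X)%N]mulnS -[X in (X <= _)%N]add1n leq_add // -mulnA mulnCA.
  apply: (@leq_trans (D ^ d.+1)%N); last by rewrite leq_pexp2l.
  by rewrite expnMn expnSr ltn_mul2l expn_gt0 /= ltnSn.
have : kermx M != 0 by rewrite -mxrank_eq0 mxrank_ker subn_eq0 -ltnNge.
case/rowV0Pn => v /sub_kermxP vM v0.
pose P : {mpoly F[e]} := \sum_a v 0 a *: 'X_[expo (enum_val a)].
have expo_inj : injective expo.
  by move=> f g /mnmP e'; apply/ffunP => i; have := e' i; rewrite !mnmE => /val_inj.
exists P.
  apply: contraNneq v0 => P0; apply/eqP/rowP => a; rewrite mxE.
  have := congr1 (mcoeff (expo (enum_val a))) P0.
  rewrite mcoeff0 raddf_sum /= (bigD1 a) //= mcoeffZ mcoeffX eqxx mulr1 big1 ?addr0 //.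
  move=> b ba; rewrite mcoeffZ mcoeffX; case: eqP => [/expo_inj/enum_val_inj e'|_].
    by rewrite e' eqxx in ba.
  by rewrite mulr0.
apply/mpolyP => k; rewrite mcoeff0.
have szX f : (msize (comp_mpoly h 'X_[expo f]) <= B)%N.
  rewrite comp_mpolyX; apply: leq_trans (msize_prod_bound _ (k := fun=> D * m.+1)%N _) _.
    move=> i; rewrite mnmE; move: (f i) => c.
    have hm : (msize (tnth h i) <= m.+1)%N by rewrite ltnW // ltnS; apply: leq_bigmax.
    have : (msize (tnth h i ^+ c) <= (c * m.+1).+1)%N.
      elim: (c : nat) => [|n IH]; first by rewrite expr0 msize1.
      by rewrite exprS mulSn msizeM_bound // ltnW.
    by move/leq_trans; apply; rewrite ltnS leq_mul2r ltnW // orbT.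
  by rewrite sum_nat_const card_ord mulnA.
have -> : comp_mpoly h P = \sum_a v 0 a *: comp_mpoly h 'X_[expo (enum_val a)].
  by rewrite /P (raddf_sum (comp_mpoly h)); apply: eq_bigr => a _; rewrite /= comp_mpolyZ.
rewrite (raddf_sum (mcoeff k)) /=.
case: (boolP [forall i, (k i < B)%N]) => [/forallP kB|]; last first.
  rewrite negb_forall => /existsP[i ki]; rewrite big1 // => a _.
  rewrite mcoeffZ (memN_msupp_eq0 (m := k)) ?mulr0 //.
  apply: contra ki => /msize_mdeg_lt kk; apply: (@leq_ltn_trans (mdeg k)); last exact: leq_trans kk (szX _).
  by rewrite mdegE (bigD1 i) //= leq_addr.
have [b eb] : exists b : 'I_#|{ffun 'I_d -> 'I_B}|, k = expo' (enum_val b).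
  exists (enum_rank [ffun i => Ordinal (kB i)]); apply/mnmP => i.
  by rewrite mnmE enum_rankK ffunE.
have := congr1 (fun A : 'rV_ _ => A 0 b) vM; rewrite mxE [RHS]mxE => vMb.
by rewrite -[RHS]vMb; apply: eq_bigr => a _; rewrite mcoeffZ mxE eb.
Qed.

(** Substituting the parametrisation turns [g] into [e] polynomials in [d] variables; a relation
    between them vanishes on [Z]. *)
Lemma alg_indep_on_le n (Z : set 'M[F]_n) d (Phi : 'M[{mpoly F[d]}]_n) e
    (g : e.-tuple {mpoly F[n * n]}) :
  (forall X, Z X -> exists v, X = map_mx (meval v) Phi) ->
  alg_indep_on Z g -> (e <= d)%N.
Proof.
move=> param indep; rewrite leqNgt; apply/negP => de.
pose q : (n * n).-tuple {mpoly F[d]} := [tuple mxvec Phi 0 k | k < n * n].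
have [P P0 Pg] := alg_dependent [tuple comp_mpoly q (tnth g i) | i < e] de.
case/eqP: P0; apply: indep => X ZX; have [v ->] := param X ZX.
rewrite /mxeval comp_mpoly_meval.
have := congr1 (meval v) Pg; rewrite meval0 comp_mpoly_meval => <-.
apply: meval_eq => i; rewrite tnth_mktuple comp_mpoly_meval.
by apply: meval_eq => k; rewrite tnth_mktuple -map_mxvec mxE.
Qed.

End AlgebraicDependence.

(** * Non-vanishing points and independence along curves *)

Section Infinite.
Variable F : numFieldType.

Lemma poly_nonzero_pt (q : {poly F}) : q != 0 -> exists x, q.[x] != 0.
Proof.
move=> q0; pose r := [seq i%:R : F | i <- iota 0 (size q)].
have ur : uniq r by rewrite map_inj_uniq ?iota_uniq // => i j /eqP; rewrite eqr_nat => /eqP.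
have [/allP ar|] := boolP (all (root q) r).
  have := max_poly_roots q0 _ ur; rewrite size_map size_iota ltnn => /(_ _).
  by move=> h; have := h (introT allP ar).
by rewrite -has_predC => /hasP[x _ /= nx]; exists x.
Qed.

Lemma digits_inj d N (a b : 'I_d -> nat) :
  (forall i, a i < N)%N -> (forall i, b i < N)%N ->
  (\sum_i a i * N ^ i = \sum_i b i * N ^ i)%N -> a =1 b.
Proof.
elim: d a b => [|d IH] a b aN bN; first by move=> _ [].
have N0 : (0 < N)%N by apply: leq_ltn_trans (aN ord0).
have E (c : 'I_d.+1 -> nat) : (\sum_i c i * N ^ i =
    c ord0 + N * \sum_(i < d) c (lift ord0 i) * N ^ i)%N.
  rewrite big_ord_recl expn0 muln1 big_distrr /=; congr (_ + _)%N.
  by apply: eq_bigr => i _; rewrite expnS mulnCA.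
rewrite !E => e.
have e0 : a ord0 = b ord0.
  by have := congr1 (modn^~ N) e; rewrite !(addnC _ (N * _)%N) !(mulnC N) !modnMDl !modn_small ?aN ?bN.
have /IH IHe : (\sum_(i < d) a (lift ord0 i) * N ^ i = \sum_(i < d) b (lift ord0 i) * N ^ i)%N.
  by apply/eqP; rewrite -(eqn_pmul2l N0) -(eqn_add2l (a ord0)) e e0.
move=> i; case: (unliftP ord0 i) => [j|] -> //; apply: IHe => k; [exact: aN | exact: bN].
Qed.

(* Kronecker substitution: [x_i := x ^ (N ^ i)]. *)
Lemma mpoly_nonzero_pt d (P : {mpoly F[d]}) : P != 0 -> exists v, P.@[v] != 0.
Proof.
move=> P0; pose N := msize P.
pose E (m : 'X_{1..d}) := (\sum_(i < d) m i * N ^ i)%N.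
have small m i : m \in msupp P -> (m i < N)%N.
  move=> /msize_mdeg_lt; apply: leq_ltn_trans.
  by rewrite mdegE (bigD1 i) //= leq_addr.
pose q : {poly F} := \sum_(m <- msupp P) P@_m *: 'X^(E m).
have [|x qx] := @poly_nonzero_pt q.
  have [m0 m0P] : exists m, m \in msupp P.
    by move: P0; rewrite -msupp_eq0; case: (msupp P) => // m r _; exists m; rewrite inE eqxx.
  apply: (contraTneq _ m0P) => q0; rewrite mcoeff_msupp negbK.
  have := congr1 (fun p : {poly F} => p`_(E m0)) q0; rewrite coef0 coef_sum.
  rewrite (bigD1_seq m0) ?msupp_uniq //= coefZ coefXn eqxx mulr1 big_seq_cond big1 ?addr0.
    by move->; rewrite eqxx.
  move=> m /andP[mP mm0]; rewrite coefZ coefXn; case: eqP => [e|_]; last by rewrite mulr0.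
  case/eqP: mm0; apply/mnmP => i; apply/esym; move: i.
  by apply: (digits_inj (N := N)) => [i|i|]; [exact: small | exact: small | exact: e].
exists (fun i => x ^+ (N ^ i)); rewrite mevalE.
apply: contraNneq qx => <-; apply/eqP; rewrite /q horner_sum; apply: eq_bigr => m _.
rewrite hornerZ hornerXn; congr (_ * _); rewrite /E -prodrXr.
by apply: eq_bigr => i _; rewrite mulnC exprM.
Qed.

(* If [P] vanishes on the functions [X |-> (X - X0) K], then along the given
   curves the lowest homogeneous component of [P] vanishes at every vector. *)
Lemma alg_indep_on_curves n (Z : set 'M[F]_n) d (X0 : 'M[F]_n) (K : 'M[F]_(n * n, d)) :
  (forall v : 'rV_d, exists (W : 'M[{poly F}]_n) (q : {poly F}),
     [/\ q != 0, mxvec (map_mx (horner_eval 0) W) *m K = v &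
         forall x, q.[x] != 0 -> Z (X0 + x *: map_mx (horner_eval x) W)]) ->
  exists f : d.-tuple {mpoly F[n * n]}, alg_indep_on Z f.
Proof.
move=> curves.
pose f k : {mpoly F[n * n]} := \sum_j K j k *: ('X_j - (mxvec X0 0 j)%:MP).
have fE k X : mxeval (f k) (X0 + X) = (mxvec X *m K) 0 k.
  rewrite /mxeval raddf_sum /= mxE; apply: eq_bigr => j _.
  rewrite mevalZ mevalB mevalXU mevalC mulrC; congr (_ * _).
  by rewrite linearD mxE /= [LHS]addrC addKr.
exists [tuple f k | k < d] => P vanish; apply/eqP; apply: contraT => P0.
have [m1 m1P] : exists m, m \in msupp P.
  by move: P0; rewrite -msupp_eq0; case: (msupp P) => // m r _; exists m; rewrite inE eqxx.
have [m0 m0P min0] : exists2 m0, m0 \in msupp P & forall m, m \in msupp P -> (mdeg m0 <= mdeg m)%N.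
  have exk : exists k, has (fun m => mdeg m == k) (msupp P).
    by exists (mdeg m1); apply/hasP; exists m1.
  case: (ex_minnP exk) => k /hasP[m mP /eqP <-] mink; exists m => // m' m'P.
  by apply: mink; apply/hasP; exists m'.
pose Q : {mpoly F[d]} := \sum_(m <- msupp P | mdeg m == mdeg m0) P@_m *: 'X_[m].
have Q0 : Q != 0.
  apply: (contraTneq _ m0P) => Q0; rewrite mcoeff_msupp negbK.
  have := congr1 (mcoeff m0) Q0; rewrite mcoeff0 raddf_sum /=.
  rewrite -big_filter (bigD1_seq m0) ?filter_uniq ?msupp_uniq ?mem_filter ?eqxx //=.
  rewrite mcoeffZ mcoeffX eqxx mulr1 big1 ?addr0; first by move->; rewrite eqxx.
  by move=> m mm0; rewrite mcoeffZ mcoeffX (negbTE mm0) mulr0.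
have [v Qv] := mpoly_nonzero_pt Q0.
have [W [q [q0 W0 ZW]]] := curves (\row_k v k).
(* [w] gives the functions [f] along the curve divided by the parameter, and [S] is [P] along the
   curve divided by its lowest power; hence [S] at 0 is [Q] at [v]. *)
pose w k : {poly F} := \sum_j mxvec W 0 j * (K j k)%:P.
have wE x k : (w k).[x] = (mxvec (map_mx (horner_eval x) W) *m K) 0 k.
  rewrite mxE horner_sum; apply: eq_bigr => j _.
  by rewrite hornerM hornerC -map_mxvec mxE.
pose S : {poly F} := \sum_(m <- msupp P) P@_m *: ('X^(mdeg m - mdeg m0) * \prod_k w k ^+ m k).
have SE x : x ^+ mdeg m0 * S.[x] = P.@[fun k => x * (w k).[x]].
  rewrite mevalE horner_sum big_distrr /=; apply: eq_big_seq => m mP.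
  rewrite hornerZ hornerM hornerXn horner_prod mulrCA; congr (_ * _).
  rewrite mulrA -exprD subnKC ?min0 // mdegE -prodrXr -big_split /=.
  by apply: eq_bigr => k _; rewrite horner_exp exprMn.
have S0 : S.[0] = Q.@[v].
  rewrite /Q raddf_sum /= horner_sum [RHS]big_mkcond; apply: eq_big_seq => m mP /=.
  rewrite hornerZ hornerM hornerXn; case: eqP => [->|/eqP ne].
    rewrite subnn expr0 mul1r mevalZ mevalX horner_prod; congr (_ * _).
    by apply: eq_bigr => k _; rewrite horner_exp wE W0 mxE.
  by rewrite expr0n subn_eq0 leqNgt ltn_neqAle eq_sym ne min0 // mul0r mulr0.
have [|x] := @poly_nonzero_pt (S * (q * 'X)).
  by rewrite !mulf_neq0 // ?polyX_eq0 //; apply: contraNneq Qv => S00; rewrite -S0 S00 horner0.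
rewrite !hornerM hornerX !mulf_eq0 !negb_or => /and3P[Sx qx x0].
case/eqP: Sx; apply: (mulfI (expf_neq0 (mdeg m0) x0)); rewrite mulr0 SE.
have := vanish _ (ZW x qx); rewrite /mxeval comp_mpoly_meval => <-.
apply: meval_eq => k; rewrite tnth_mktuple -/(mxeval _ _) fE wE.
by rewrite [in RHS]linearZ /= -scalemxAl [RHS]mxE.
Qed.

End Infinite.

(** * Parametrisation of the orbits *)

Lemma linear_rV_mx (F : fieldType) m p (f : 'rV[F]_m -> 'rV[F]_p) :
  linear f -> exists A : 'M_(m, p), forall v, f v = v *m A.
Proof.
move=> lf; pose g : {linear 'rV[F]_m -> 'rV[F]_p} :=
  HB.pack f (GRing.isLinear.Build _ _ _ _ f lf).
by exists (lin1_mx g) => v; rewrite mul_rV_lin1.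
Qed.

Section Parametrisation.
Variables (n : nat) (s : 'S_n).
Hypothesis sK : forall k, s (s k) = k.

Definition free_pairs : {set 'I_n * 'I_n} :=
  [set pq : 'I_n * 'I_n | (pq.1 <= pq.2)%N && (pq \notin stab_pairs s)].

Section Ring.
Variable A : comNzRingType.
Implicit Types M : 'M[A]_n.

Definition arc_mx : 'M[A]_n := \matrix_(i, j) ((i < j)%N && (s i == j))%:R.
Definition nil_part M : 'M[A]_n := \matrix_(i, j) if (i < j)%N then M i j else 0.
Definition diag_part M : 'M[A]_n := \matrix_(i, j) if i == j then M i j else 0.
(* [M] packs the parameters of [u N_s h u^-1], with [u] unipotent given by the
   entries above the diagonal and [h] diagonal. *)
Definition orbit_pt M : 'M[A]_n :=
  (1%:M + nil_part M) *m (arc_mx *m diag_part M) *m \adj (1%:M + nil_part M).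
Definition spread (x : 'rV[A]_#|free_pairs|) : 'M[A]_n :=
  \matrix_(i, j) \sum_(k | enum_val k == (i, j)) x 0 k.

Lemma mul_arc_mx M a c :
  (arc_mx *m M) a c = if (a < s a)%N then M (s a) c else 0.
Proof.
rewrite mxE; case: ifP => h.
  rewrite (bigD1 (s a)) //= mxE h eqxx mul1r big1 ?addr0 // => k ka.
  by rewrite mxE eq_sym (negbTE ka) andbF mul0r.
apply: big1 => k _; rewrite mxE; case: eqP => [<-|_]; first by rewrite h mul0r.
by rewrite andbF mul0r.
Qed.

Lemma mul_mx_arc M a c :
  (M *m arc_mx) a c = if (s c < c)%N then M a (s c) else 0.
Proof.
rewrite mxE; case: ifP => h.
  rewrite (bigD1 (s c)) //= mxE sK h eqxx mulr1 big1 ?addr0 // => k kc.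
  rewrite mxE; case: eqP => [e|_]; last by rewrite andbF mulr0.
  by rewrite -e sK eqxx in kc.
apply: big1 => k _; rewrite mxE; case: eqP => [e|_]; last by rewrite andbF mulr0.
by rewrite -e sK in h; rewrite -e h mulr0.
Qed.

Lemma spreadE x k : spread x (enum_val k).1 (enum_val k).2 = x 0 k.
Proof.
rewrite mxE (bigD1 k) /=; last by rewrite -surjective_pairing.
rewrite big1 ?addr0 // => l /andP[/eqP e lk]; case/eqP: lk.
by apply: enum_val_inj; rewrite e -surjective_pairing.
Qed.

Lemma spread_notin x i j : (i, j) \notin free_pairs -> spread x i j = 0.
Proof.
move=> h; rewrite mxE big1 // => k /eqP e; case/negP: h.
by rewrite -e; apply: enum_valP.
Qed.

Lemma spread_gather M : (forall i j, (i, j) \notin free_pairs -> M i j = 0) ->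
  M = spread (\row_k M (enum_val k).1 (enum_val k).2).
Proof.
move=> M0; apply/matrixP => i j.
have [ijF|ijF] := boolP ((i, j) \in free_pairs); last by rewrite M0 // spread_notin.
pose k := enum_rank_in ijF (i, j).
have ek : enum_val k = (i, j) by apply: enum_rankK_in.
by have := spreadE (\row_k M (enum_val k).1 (enum_val k).2) k; rewrite [RHS]mxE ek => ->.
Qed.

Lemma spread_linear : linear spread.
Proof.
move=> a x y; apply/matrixP => i j; rewrite !mxE mulr_sumr -big_split /=.
by apply: eq_bigr => k _; rewrite !mxE.
Qed.

Lemma nil_part_linear : linear nil_part.
Proof. by move=> a x y; apply/matrixP => i j; rewrite !mxE; case: ifP => _ //; rewrite mulr0 addr0. Qed.

Lemma diag_part_linear : linear diag_part.
Proof. by move=> a x y; apply/matrixP => i j; rewrite !mxE; case: ifP => _ //; rewrite mulr0 addr0. Qed.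

(** So the adjugate is the inverse, and [orbit_pt] is polynomial in its parameters. *)
Lemma det_unipotent M : \det (1%:M + nil_part M) = 1.
Proof.
rewrite -det_tr det_trig; last first.
  apply/is_trig_mxP => i j ij; rewrite !mxE -val_eqE /= (gtn_eqF ij).
  by rewrite ltnNge ltnW //= add0r.
by rewrite big1 // => i _; rewrite !mxE eqxx ltnn addr0.
Qed.

Lemma unipotent_adjK M :
  (1%:M + nil_part M) *m \adj (1%:M + nil_part M) = 1%:M.
Proof. by rewrite mul_mx_adj det_unipotent. Qed.

Lemma adj_unipotentK M :
  \adj (1%:M + nil_part M) *m (1%:M + nil_part M) = 1%:M.
Proof. by rewrite mul_adj_mx det_unipotent. Qed.

End Ring.

Lemma map_orbit_pt (A B : comNzRingType) (f : {rmorphism A -> B}) (M : 'M[A]_n) :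
  map_mx f (orbit_pt M) = orbit_pt (map_mx f M).
Proof.
have e1 : map_mx f (1%:M + nil_part M) = 1%:M + nil_part (map_mx f M).
  rewrite map_mxD map_mx1; congr (_ + _); apply/matrixP => i j; rewrite !mxE.
  by case: ifP; rewrite ?raddf0.
rewrite /orbit_pt !map_mxM map_mx_adj e1; congr (_ *m (_ *m _) *m _).
  by apply/matrixP => i j; rewrite !mxE rmorph_nat.
by apply/matrixP => i j; rewrite !mxE; case: ifP; rewrite ?raddf0.
Qed.

Lemma map_spread (A B : comNzRingType) (f : {rmorphism A -> B}) x :
  map_mx f (spread x) = spread (map_mx f x).
Proof. by apply/matrixP => i j; rewrite !mxE rmorph_sum; apply: eq_bigr => k _; rewrite mxE. Qed.

End Parametrisation.

(** * Normalisation by the centraliser *)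

Section Stabiliser.
Variables (F : fieldType) (n : nat) (s : 'S_n).
Hypothesis sK : forall k, s (s k) = k.
Implicit Types M y : 'M[F]_n.

Local Notation I := (stab_pairs s).

(* The element of the centraliser of [N_s] with coordinates [y] on [stab_pairs];
   the entries of [y] outside [stab_pairs] are ignored. *)
Definition stab_mx y : 'M[F]_n := \matrix_(p, q)
  if (p, q) \in I then y p q
  else if [&& (s p < p)%N, (s q < q)%N, (p <= q)%N & (s p, s q) \in I]
  then y (s p) (s q) else 0.

Lemma stab_mx_linear : linear stab_mx.
Proof.
move=> a x y; apply/matrixP => i j; rewrite !mxE.
by case: ifP => _; [|case: ifP => _] => //; rewrite mulr0 addr0.
Qed.

Lemma stab_mx_upper y (p q : 'I_n) : (q < p)%N -> stab_mx y p q = 0.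
Proof.
move=> qp; rewrite mxE inE /= leqNgt qp /=.
by rewrite !andbF.
Qed.

(** At [(a, c)] the entries at [(a, s c)] and [(s a, c)] are equated if [a] is a left end and [c] a
    right end; if only one of these holds, the lone entry must vanish. *)
Lemma stab_mx_comm y : stab_mx y *m arc_mx s F = arc_mx s F *m stab_mx y.
Proof.
apply/matrixP => a c; rewrite mul_mx_arc // mul_arc_mx !mxE !sK.
case: (ltnP (s c) c) => hc; case: (ltnP a (s a)) => ha //=.
- have -> : ((s a, c) \in I) = false by rewrite inE /= sK; lia.
  rewrite (ltnNge (s a)) (ltnW ha) /=.
  case: ifP => h; last by rewrite !andbF.
  by rewrite ifT //; move: h; rewrite inE /= sK; lia.
- have -> : ((a, s c) \in I) = false by rewrite inE /= sK; lia.
  by rewrite ifF //; lia.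
- have -> : ((s a, c) \in I) = false by rewrite inE /= sK; lia.
  by [].
Qed.

(** Back substitution from the bottom of each column. Columns of left ends come first, as [stab_mx]
    vanishes there outside [I]; elsewhere its entries outside [I] are zero or copied from those
    columns. *)
Lemma stab_mx_inj (b y : 'M[F]_n) : (forall i, b i i != 0) -> (forall i j : 'I_n, (j < i)%N -> b i j = 0) ->
  (forall p q, (p, q) \in I -> (b *m stab_mx y) p q = 0) -> stab_mx y = 0.
Proof.
move=> bd bu by0.
have col q : (forall p, (p, q) \notin I -> stab_mx y p q = 0) -> forall p, stab_mx y p q = 0.
  move=> out p; have [m] := ubnP (n - p)%N; elim: m p => // m IH p pm.
  have [pI|/out//] := boolP ((p, q) \in I).
  have := by0 p q pI; rewrite mxE (bigD1 p) //= big1 ?addr0.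
    by move/eqP; rewrite mulf_eq0 (negbTE (bd p)) => /eqP.
  move=> r rp; case: (ltngtP r p) => h; first by rewrite bu ?mul0r.
    by rewrite IH ?mulr0 //; have := ltn_ord r; lia.
  by case/eqP: rp; apply: val_inj.
have left (p q : 'I_n) : (q < s q)%N -> stab_mx y p q = 0.
  move=> hq; apply: (col q) => {}p pI; rewrite mxE (negbTE pI) ifF //.
  by apply/negP => /and4P[_ +]; lia.
apply/matrixP => p q; rewrite [RHS]mxE; apply: col => {}p pI; rewrite mxE (negbTE pI).
case: ifP => // /and4P[_ h _ h'].
by have := left (s p) (s q); rewrite sK => /(_ h); rewrite mxE h'.
Qed.

(** The conditions on [I], completed by the identity outside [I], form an injective linear
    endomorphism [E], which is therefore onto. *)
Lemma stab_mx_normalise (b : 'M[F]_n) : (forall i, b i i != 0) ->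
  (forall i j : 'I_n, (j < i)%N -> b i j = 0) ->
  exists y, forall p q, (p, q) \in I -> (b *m stab_mx y) p q = (p == q)%:R.
Proof.
move=> bd bu.
pose E y : 'M[F]_n := \matrix_(p, q) if (p, q) \in I then (b *m stab_mx y) p q else y p q.
have lE : linear (fun v : 'rV_(n * n) => mxvec (E (vec_mx v))).
  move=> a u v; rewrite -linearP /=; congr mxvec; apply/matrixP => p q.
  rewrite [RHS]mxE [X in _ = X + _]mxE ![E _ _ _]mxE linearP /= stab_mx_linear mulmxDr.
  by rewrite -scalemxAr; case: ifP => _; rewrite !mxE.
have [A EA] := linear_rV_mx lE.
have : row_free A.
  apply: inj_row_free => v; rewrite -EA => Ev.
  have {}Ev : E (vec_mx v) = 0 by apply: (can_inj mxvecK); rewrite Ev linear0.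
  have S0 : stab_mx (vec_mx v) = 0.
    apply: (stab_mx_inj bd bu) => p q pq; have := congr1 (fun M : 'M_n => M p q) Ev.
    by rewrite mxE pq [RHS]mxE.
  apply: (can_inj vec_mxK); rewrite linear0; apply/matrixP => p q.
  have [pq|pq] := boolP ((p, q) \in I).
    by have := congr1 (fun M : 'M_n => M p q) S0; rewrite mxE pq.
  by have := congr1 (fun M : 'M_n => M p q) Ev; rewrite mxE (negbTE pq).
rewrite row_free_unit => uA.
exists (vec_mx (mxvec 1%:M *m invmx A)) => p q pq.
have := EA (mxvec 1%:M *m invmx A); rewrite mulmxKV // => /(can_inj mxvecK).
by move/(congr1 (fun M : 'M_n => M p q)); rewrite mxE pq => ->; rewrite mxE.
Qed.

End Stabiliser.

(** * The differential of the parametrisation *)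

Section Tangent.
Variables (F : fieldType) (n : nat) (s : 'S_n).
Hypothesis sK : forall k, s (s k) = k.
Implicit Types V : 'M[F]_n.

(* The differential of [orbit_pt] at the point where [u = 1] and [h] has
   entry 1 at the right ends. *)
Definition tangent V : 'M[F]_n :=
  nil_part V *m arc_mx s F + arc_mx s F *m (diag_part V - nil_part V).

Lemma tangent_linear : linear tangent.
Proof.
move=> a x y; rewrite /tangent nil_part_linear diag_part_linear opprD addrACA.
rewrite -scalerN -scalerDr mulmxDl mulmxDr -scalemxAl -scalemxAr.
by rewrite scalerDr addrACA.
Qed.

(** For columns of left ends the second term of the equation is absent or lies below the diagonal.
    The remaining columns then follow, since their equations involve only those columns besides the
    entry sought. *)
Lemma tangent_inj V : (forall i j, (i, j) \notin free_pairs s -> V i j = 0) ->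
  tangent V = 0 -> V = 0.
Proof.
move=> supp TV.
have Vlow (i j : 'I_n) : (j < i)%N -> V i j = 0 by move=> h; rewrite supp // inE /= leqNgt h.
have Vstab i j : (i, j) \in stab_pairs s -> V i j = 0.
  by move=> h; rewrite supp // inE h andbF.
have E a c : (if (s c < c)%N then nil_part V a (s c) else 0)
    + (if (a < s a)%N then (diag_part V - nil_part V) (s a) c else 0) = 0.
  have := congr1 (fun M : 'M_n => M a c) TV.
  by rewrite mxE [RHS]mxE mul_mx_arc // mul_arc_mx.
have dn i j : (diag_part V - nil_part V) i j = 0 -> V i j = 0.
  rewrite !mxE -val_eqE /=; case: (ltngtP i j) => [_|/Vlow ->|_] //.
    by rewrite sub0r => /eqP; rewrite oppr_eq0 => /eqP.
  by rewrite subr0.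
have nd i j : V i j = 0 -> (diag_part V - nil_part V) i j = 0.
  by rewrite !mxE => ->; rewrite !if_same subr0.
have left (p q : 'I_n) : (q < s q)%N -> V p q = 0.
  move=> hq; case: (ltnP q p) => [|pq]; first exact: Vlow.
  have [/andP[h1 h2]|h] := boolP ((p < s p) && (s p <= s q))%N.
    by apply: Vstab; rewrite inE /= pq h1 hq h2 orbT.
  have := E p (s q); rewrite sK hq [X in X + _]mxE.
  have -> : (if (p < s p)%N then (diag_part V - nil_part V) (s p) (s q) else 0) = 0.
    by case: ifP => // hp; apply: nd; apply: Vlow; rewrite ltnNge; apply: contra h; rewrite hp.
  rewrite addr0; case: ltngtP pq => // e _ _.
  by apply: Vstab; rewrite inE /= (val_inj e) leqnn hq /= leqnn orbT.
apply/matrixP => p q; rewrite [RHS]mxE; case: (ltnP q (s q)) => [|hq]; first exact: left.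
case: (ltnP q p) => [|pq]; first exact: Vlow.
case: (leqP p (s p)) => hp; first by apply: Vstab; rewrite inE /= pq hp hq.
have := E (s p) q; rewrite sK hp => e; apply: dn; move: e.
suff -> : (if (s q < q)%N then nil_part V (s p) (s q) else 0) = 0 by rewrite add0r.
by case: ifP => // hq'; rewrite mxE left ?sK ?if_same.
Qed.

End Tangent.

(** * Dimension of the orbits *)

Section Orbit.
Variables (R : realType) (n : nat) (s : 'S_n).
Hypothesis sK : forall k, s (s k) = k.
Local Notation C := R[i].
Implicit Types M : 'M[C]_n.

Lemma NmxE : Nmx R s = arc_mx s C.
Proof. by []. Qed.

Lemma upper_unit (b : 'M[C]_n) : (forall i j : 'I_n, (j < i)%N -> b i j = 0) ->
  (b \in unitmx) = [forall i, b i i != 0].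
Proof.
move=> bu; rewrite unitmxE unitfE -det_tr det_trig; last first.
  by apply/is_trig_mxP => i j ij; rewrite mxE bu.
apply/prodf_neq0/forallP => h i; first by have := h i isT; rewrite mxE.
by move=> _; rewrite mxE.
Qed.

(** The diagonal parameters at right ends absorb the torus part. *)
Lemma arc_diag_cancel M (d : 'rV[C]_n) :
  (forall a : 'I_n, (a < s a)%N -> M (s a) (s a) * d 0 (s a) = d 0 a) ->
  arc_mx s C *m diag_part M *m diag_mx d = diag_mx d *m arc_mx s C.
Proof.
move=> h; rewrite mul_mx_diag mul_diag_mx; apply/matrixP => a c.
rewrite mxE mul_arc_mx [RHS]mxE mxE [arc_mx _ _ _ _]mxE.
case: (eqVneq (s a) c) => [<-|_]; rewrite ?andbT ?andbF.
  by case: ifP => ha; [rewrite h // mulr1 | rewrite mul0r mulr0].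
by rewrite if_same mul0r mulr0.
Qed.

Lemma orbit_pt_eq M X : X *m (1%:M + nil_part M) =
    (1%:M + nil_part M) *m (arc_mx s C *m diag_part M) -> X = orbit_pt s M.
Proof. by move=> h; rewrite /orbit_pt -h -mulmxA unipotent_adjK mulmx1. Qed.

Lemma orbit_pt_surj X : Borbit R s X -> exists2 M : 'M[C]_n,
  (forall i j, (i, j) \notin free_pairs s -> M i j = 0) & X = orbit_pt s M.
Proof.
move=> [b [ub bu] eX].
have bd i : b i i != 0 by move: i; apply/forallP; rewrite -upper_unit.
have [y by1] := stab_mx_normalise sK bd bu.
set S := stab_mx s y in by1; pose t := b *m S.
have Xt : X *m t = t *m arc_mx s C.
  by rewrite eX /t !mulmxA mulmxKV // -!mulmxA -stab_mx_comm.
have tu (i j : 'I_n) : (j < i)%N -> t i j = 0.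
  move=> ji; rewrite mxE big1 // => k _; case: (ltnP k i) => ki; first by rewrite bu ?mul0r.
  by rewrite [S _ _]stab_mx_upper ?mulr0 // (leq_trans ji).
have tdE i : t i i = b i i * S i i.
  rewrite mxE (bigD1 i) //= big1 ?addr0 // => k ki.
  case: (ltngtP k i) => h; first by rewrite bu ?mul0r.
    by rewrite [S _ _]stab_mx_upper ?mulr0.
  by case/eqP: ki; apply: val_inj.
have t1 (i : 'I_n) : (i <= s i)%N -> t i i = 1.
  move=> h; rewrite by1 ?eqxx // inE /= leqnn /=.
  by move: h; lia.
have td i : t i i != 0.
  case: (leqP i (s i)) => h; first by rewrite t1 // oner_neq0.
  rewrite tdE mulf_neq0 //.
  (* The diagonal of a centraliser element agrees at both ends of an arc, and the left end is
     already normalised. *)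
  have -> : S i i = S (s i) (s i).
    have m1 : ((i, i) \in stab_pairs s) = false by rewrite inE /=; lia.
    have m2 : ((s i, s i) \in stab_pairs s) by rewrite inE /= sK; lia.
    by rewrite [LHS]mxE [RHS]mxE m1 m2 h leqnn.
  have : t (s i) (s i) != 0 by rewrite t1 ?oner_neq0 // sK ltnW.
  by rewrite tdE mulf_eq0 negb_or => /andP[].
have tI p q : (p, q) \in stab_pairs s -> t p q = (p == q)%:R by exact: by1.
move: t Xt tu t1 td tI {tdE} => t Xt tu t1 td tI.
(* [t] factors as unipotent times [diag_mx d], where [d] is 1 except at right ends; its inverse
   there gives the diagonal parameters. *)
pose M : 'M[C]_n := \matrix_(p, q)
  if (p < q)%N then t p q / t q q else if (p == q) && (s p < p)%N then (t p p)^-1 else 0.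
pose d : 'rV[C]_n := \row_j t j j.
have uD : (1%:M + nil_part M) *m diag_mx d = t.
  rewrite mul_mx_diag; apply/matrixP => i j; rewrite !mxE -val_eqE /=.
  case: (ltngtP i j) => h; first by rewrite mulr0n add0r divfK.
    by rewrite mulr0n addr0 mul0r tu.
  by rewrite (val_inj h) addr0 mul1r.
have D1 : diag_mx d \in unitmx.
  by rewrite unitmxE det_diag unitfE; apply/prodf_neq0 => i _; rewrite mxE.
exists M => [i j ijF|].
  rewrite mxE; move: ijF; rewrite inE negb_and negbK /= -val_eqE /=.
  case: (ltngtP i j) => h //= ijI; first by rewrite tI // -val_eqE /= (ltn_eqF h) mul0r.
  by case: ifP => // hs; move: ijI; rewrite inE /= -(val_inj h); lia.
apply: orbit_pt_eq; apply: (row_free_inj (A := diag_mx d)); first by rewrite row_free_unit.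
rewrite /= -[LHS]mulmxA uD Xt -[RHS]mulmxA arc_diag_cancel; last first.
  move=> a ha; rewrite !mxE ltnn eqxx sK ha /= mulVf // t1 //; exact: ltnW.
by rewrite mulmxA uD.
Qed.

Lemma orbit_pt_in M : (forall j : 'I_n, (s j < j)%N -> M j j != 0) ->
  Borbit R s (orbit_pt s M).
Proof.
move=> Mj; pose d : 'rV[C]_n := \row_j if (s j < j)%N then (M j j)^-1 else 1.
set u := 1%:M + nil_part M; pose b := u *m diag_mx d.
have ub : b \in unitmx.
  rewrite unitmx_mul unitmxE det_unipotent unitr1 unitmxE det_diag unitfE /=.
  by apply/prodf_neq0 => i _; rewrite mxE; case: ifP => h; rewrite ?oner_neq0 // invr_neq0 ?Mj.
exists b.
  split=> // i j ji; rewrite /b mul_mx_diag !mxE -val_eqE /= (gtn_eqF ji).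
  by rewrite ltnNge ltnW // add0r mul0r.
rewrite /orbit_pt -/u; apply: (canRL (mulmxK ub)).
rewrite NmxE /b -[RHS]mulmxA -(arc_diag_cancel (M := M)); last first.
  by move=> a ha; rewrite !mxE sK ha ltnNge ltnW //= divff // Mj // sK.
by rewrite !mulmxA -[_ *m \adj u *m u]mulmxA adj_unipotentK mulmx1.
Qed.

Lemma orbit_curve (V : 'M[C]_n) :
  (forall i j, (i, j) \notin free_pairs s -> V i j = 0) ->
  exists (W : 'M[{poly C}]_n) (q : {poly C}),
    [/\ q != 0, map_mx (horner_eval 0) W = tangent s V &
      forall x, q.[x] != 0 ->
        Borbit R s (arc_mx s C + x *: map_mx (horner_eval x) W)].
Proof.
move=> supp; pose N := arc_mx s C; pose nu := nil_part V; pose h := diag_part V.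
pose cst : 'M[C]_n -> 'M[{poly C}]_n := map_mx polyC.
pose U := 1%:M + nil_part ('X *: cst V).
(* Found by expanding $(1+x\nu)(N+xNh)-N(1+x\nu)$, dividing by $x$ and removing the unipotent
   factor. *)
exists ((cst (tangent s V) + 'X *: cst (nu *m N *m h)) *m \adj U).
(* Where this is nonzero, the diagonal parameters [1 + x * V j j] at right ends are too, as
   [orbit_pt_in] requires. *)
exists (\prod_j (1 + 'X * (V j j)%:P)).
have cstK x M : map_mx (horner_eval x) (cst M) = M.
  by apply/matrixP => i j; rewrite !mxE /horner_eval hornerC.
have XK x M : map_mx (horner_eval x) ('X *: cst M) = x *: M.
  by rewrite map_mxZ cstK /= /horner_eval hornerX.
have WE x : map_mx (horner_eval x)
    ((cst (tangent s V) + 'X *: cst (nu *m N *m h)) *m \adj U) =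
  (tangent s V + x *: (nu *m N *m h)) *m \adj (1%:M + nil_part (x *: V)).
  rewrite map_mxM map_mxD cstK XK map_mx_adj; congr (_ *m \adj _).
  rewrite map_mxD map_mx1; congr (_ + _); apply/matrixP => i j; rewrite !mxE.
  by case: ifP; rewrite ?raddf0 //= /horner_eval hornerM hornerX hornerC.
split.
- have : (\prod_j (1 + 'X * (V j j)%:P)).[0] != 0.
    rewrite horner_prod big1 ?oner_neq0 // => j _.
    by rewrite hornerD hornerM hornerX mul0r addr0 hornerC.
  by apply: contraNneq => ->; rewrite horner0.
- rewrite WE !scale0r addr0 (_ : nil_part 0 = 0) ?addr0 ?adj1 ?mulmx1 //.
  by apply/matrixP => i j; rewrite !mxE if_same.
- move=> x qx; rewrite WE.
  pose E : 'M[C]_n := \matrix_(i, j) ((i == j) && (s i < i)%N)%:R.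
  have nilE : nil_part (E + x *: V) = nil_part (x *: V).
    apply/matrixP => i j; rewrite !mxE; case: ifP => // ij.
    by rewrite -val_eqE (ltn_eqF ij) add0r.
  have diagE : N *m diag_part (E + x *: V) = N + x *: (N *m h).
    apply/matrixP => i j; rewrite mul_arc_mx [RHS]mxE [X in _ = _ + X]mxE mul_arc_mx !mxE sK.
    case: (eqVneq (s i) j) => [<-|_]; last by rewrite andbF if_same mulr0 addr0.
    by case: ifP => hi /=; rewrite ?hi ?mulr0 ?addr0.
  rewrite (_ : _ + _ = orbit_pt s (E + x *: V)).
    apply: orbit_pt_in => j hj; rewrite !mxE eqxx hj /=.
    by move: qx; rewrite horner_prod => /prodf_neq0/(_ j isT); rewrite !hornerE.
  apply: orbit_pt_eq; rewrite nilE diagE [LHS]mulmxDl -scalemxAl.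
  rewrite -[(_ *m \adj _) *m _]mulmxA adj_unipotentK mulmx1.
  have -> : nil_part (x *: V) = x *: nu.
    by apply/matrixP => i j; rewrite !mxE; case: ifP; rewrite ?mulr0.
  rewrite [LHS]addrC mulmxDr mulmx1 mulmxDl mul1mx mulmxDr -!scalemxAl -!scalemxAr.
  rewrite /tangent -/N -/nu -/h mulmxBr mulmxA !scalerDr scalerN.
  rewrite (addrC N (_ *: _)) addrA (addrAC _ _ (x *: (N *m nu))) -(addrA _ _ (x *: (N *m nu))).
  by rewrite subrK [LHS]addrC -[RHS]addrA; congr (_ + _); rewrite addrCA addrA.
Qed.

Lemma var_dim_Borbit : var_dim (Borbit R s) = #|free_pairs s|.
Proof.
have up e (g : e.-tuple {mpoly C[n * n]}) : alg_indep_on (Borbit R s) g -> (e <= #|free_pairs s|)%N.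
  apply: (alg_indep_on_le (Phi := orbit_pt s (spread (\row_k 'X_k)))) => X.
  case/orbit_pt_surj => M supp ->; rewrite (spread_gather supp).
  set x := \row_k _; exists (fun k => x 0 k).
  rewrite map_orbit_pt map_spread; congr (orbit_pt _ (spread _)).
  by apply/rowP => k; rewrite [RHS]mxE [in RHS]mxE /= mevalXU.
have [A EA] : exists A : 'M_(#|free_pairs s|, n * n),
    forall v : 'rV[C]_#|free_pairs s|, mxvec (tangent s (spread v)) = v *m A.
  by apply: linear_rV_mx => a u v; rewrite spread_linear tangent_linear linearP.
have fA : row_free A.
  apply: inj_row_free => v; rewrite -EA => Av.
  have : spread v = 0.
    apply: tangent_inj => // [i j|]; first exact: spread_notin.
    by apply: (can_inj mxvecK); rewrite Av linear0.
  by move=> v0; apply/rowP => k; rewrite -spreadE v0 !mxE.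
have [f indep] : exists f : #|free_pairs s|.-tuple {mpoly C[n * n]}, alg_indep_on (Borbit R s) f.
  (* [pinvmx A] is a right inverse of the injective differential, so the initial direction of a
     curve has any prescribed coordinates [v]. *)
  apply: (alg_indep_on_curves (X0 := arc_mx s C) (K := pinvmx A)) => v.
  have [i j|W [q [q0 W0 ZW]]] := @orbit_curve (spread v); first exact: spread_notin.
  by exists W, q; split=> //; rewrite W0 EA -mulmxA mulmxVp // mulmx1.
apply: xget_unique; first by split; [exists f | exact: up].
move=> e [[g gi] maxe]; apply/eqP; rewrite eqn_leq (up _ g gi) /=.
exact: maxe indep.
Qed.

End Orbit.

(** * Covers, chains and depth *)

(** [M] factors through its nonzero rows [Q], and [Q] has the right inverse [Q^T]. *)
Lemma rank_partial_perm (F : fieldType) m n (M : 'M[F]_(m, n)) (L : {set 'I_m}) (g : 'I_m -> 'I_n) :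
  {in L &, injective g} -> (forall a c, M a c = ((a \in L) && (c == g a))%:R) ->
  \rank M = #|L|.
Proof.
move=> ginj ME.
pose P : 'M[F]_(m, #|L|) := \matrix_(a, l) (a == enum_val l)%:R.
pose Q : 'M[F]_(#|L|, n) := rowsub (fun l => enum_val l) M.
have MPQ : M = P *m Q.
  apply/matrixP => a c; rewrite mxE; have [aL|aL] := boolP (a \in L).
    rewrite (bigD1 (enum_rank_in aL a)) //= !mxE enum_rankK_in // eqxx mul1r.
    rewrite big1 ?addr0 // => l la; rewrite mxE; case: eqP => [e|_]; last by rewrite mul0r.
    by case/eqP: la; apply: enum_val_inj; rewrite enum_rankK_in.
  rewrite ME (negbTE aL) big1 // => l _; rewrite mxE; case: eqP => [e|_]; last by rewrite mul0r.
  by case/negP: aL; rewrite e enum_valP.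
apply/eqP; rewrite eqn_leq; apply/andP; split; first by rewrite MPQ mulmx_max_rank.
have QQ : Q *m Q^T = 1%:M.
  apply/matrixP => l l'; rewrite mxE (bigD1 (g (enum_val l))) //= !mxE !ME !enum_valP eqxx mul1r.
  rewrite big1 ?addr0; last first.
    by move=> c cl; rewrite !mxE ME enum_valP /= (negbTE cl) mul0r.
  by rewrite (inj_in_eq ginj) ?enum_valP // (inj_eq enum_val_inj).
have QM : Q = P^T *m M.
  apply/matrixP => l c; rewrite !mxE (bigD1 (enum_val l)) //= !mxE eqxx mul1r big1 ?addr0 //.
  by move=> a al; rewrite !mxE (negbTE al) mul0r.
rewrite -{1}(mxrank1 F #|L|) -QQ QM -mulmxA.
by apply: leq_trans (mxrankM_maxr _ _) (mxrankM_maxl _ _).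
Qed.

Section Main.
Variables (R : realType) (n : nat).
Implicit Types s t : 'S_n.

Lemma rankmxE s (i j : 'I_n) : rankmx R s i j = arcs_in s i j.
Proof.
rewrite mxE; case: ifP => ij; last first.
  by apply/esym/eqP; rewrite cards_eq0; apply/eqP/setP => k; rewrite !inE; lia.
pose A := idx_range i j.
pose L := [set a : 'I_#|A| | (enum_val a < s (enum_val a))%N && (s (enum_val a) <= j)%N].
have iA : i \in A by rewrite inE leqnn ltnW.
rewrite (@rank_partial_perm _ _ _ _ L (fun a => enum_rank_in iA (s (enum_val a)))).
- rewrite -(card_imset _ enum_val_inj); apply: eq_card => k; rewrite inE.
  apply/imsetP/idP => [[a + ->]|/and3P[h1 h2 h3]].
    by have := enum_valP a; rewrite !inE => /andP[-> _] /andP[-> ->].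
  have kA : k \in A by rewrite inE h1 (leq_trans (ltnW h2) h3).
  by exists (enum_rank_in iA k); rewrite ?inE enum_rankK_in // h2.
- move=> a b; rewrite !inE => /andP[a1 a2] /andP[b1 b2] /(congr1 enum_val).
  have iAa (x : 'I_#|A|) : (enum_val x < s (enum_val x))%N -> (s (enum_val x) <= j)%N -> s (enum_val x) \in A.
    move=> x1 x2; rewrite inE x2 andbT; have := @enum_valP _ A x; rewrite inE; lia.
  by rewrite !enum_rankK_in ?iAa // => /perm_inj/enum_val_inj.
- move=> a c; rewrite mxE mxE inE; congr (nat_of_bool _)%:R.
  have := @enum_valP _ A c; rewrite inE => /andP[c1 c2].
  have := @enum_valP _ A a; rewrite inE => /andP[a1 a2].
  apply/andP/andP => [[h /eqP e]|[/andP[h1 h2] /eqP ->]].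
    rewrite e c2 h; split=> //; apply/eqP/enum_val_inj.
    by rewrite enum_rankK_in // inE c1 c2.
  have sA : s (enum_val a) \in A by rewrite inE h2 andbT (leq_trans a1 (ltnW h1)).
  by rewrite enum_rankK_in.
Qed.

Lemma inv_leP s t : reflect (inle t s) (inv_le R t s).
Proof.
apply: (iffP forallP) => [h a b bn|h i]; last first.
  by apply/forallP => j; rewrite !rankmxE h.
case: (ltnP a n) => an; last by rewrite arcs_in_ge.
by have := forallP (h (Ordinal an)) (Ordinal bn); rewrite !rankmxE.
Qed.

Lemma involP s : reflect (forall k, s (s k) = k) (s \in invol n).
Proof.
rewrite inE expgS expg1; apply: (iffP eqP) => [e k|e].
  by rewrite -permM e perm1.
by apply/permP => k; rewrite permM e perm1.
Qed.

(** [descent] inserts an involution of weight one more, which must be [t]. Conversely, an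
    intermediate involution would have weight strictly between consecutive integers. *)
Lemma gen_descP s t : (forall k, s (s k) = k) -> reflect (covers s t) (gen_desc R s t).
Proof.
move=> sK; apply: (iffP and4P) => [[_ /involP tK /andP[/inv_leP ts nts] /forallP cov]|[tK ts e]].
  have [f [fK tf fs ef]] := descent sK tK ts nts.
  suff <- : f = t by [].
  have := cov f; rewrite (introT (involP f) fK) (introT (inv_leP _ _) tf) (introT (inv_leP _ _) fs) /=.
  by case/orP => /eqP // e; move: ef; rewrite e; lia.
split; [exact/involP | exact/involP | |].
  by apply/andP; split; [exact/inv_leP | apply: contra_eq_neq e => ->; lia].
apply/forallP => f; apply/implyP => /involP fK; apply/implyP => /andP[/inv_leP tf /inv_leP fs].
apply: contraT; rewrite negb_or => /andP[nfs nft].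
have := link_weight_strict sK fK fs nfs; have := link_weight_strict fK tK tf _.
by rewrite eq_sym => /(_ nft); lia.
Qed.

(** Free and stabiliser pairs together are all pairs [p <= q], so dimensions and weights differ by a
    sign and a constant. *)
Lemma codimE s t : (forall k, s (s k) = k) -> (forall k, t (t k) = k) ->
  codim R s t = (link_weight n (links t))%:Z - (link_weight n (links s))%:Z.
Proof.
move=> sK tK; rewrite /codim !var_dim_Borbit // -!card_stab_pairs //.
have E (u : 'S_n) : (#|free_pairs u| + #|stab_pairs u| = #|[set pq : 'I_n * 'I_n | (pq.1 <= pq.2)%N]|)%N.
  rewrite addnC -(cardsID (stab_pairs u) [set pq : 'I_n * 'I_n | (pq.1 <= pq.2)%N]); congr (_ + _)%N; apply: eq_card => pq.
    by rewrite !inE; case: (leqP pq.1 pq.2).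
  by rewrite !inE andbC.
have := E s; have := E t; lia.
Qed.

Lemma chain_size s c : (forall k, s (s k) = k) -> path (gen_desc R) s c ->
  (forall k, (last s c) (last s c k) = k) /\
  (link_weight n (links (last s c)) = link_weight n (links s) + size c)%N.
Proof.
elim: c s => [|f c IH] s sK /=; first by rewrite addn0.
move=> /andP[/(gen_descP _ sK)[fK _ e] pc].
by have [lK ->] := IH f fK pc; rewrite e addSnnS.
Qed.

Lemma chain_codim s t c : (forall k, s (s k) = k) -> is_chain R s t c ->
  (size c)%:Z = codim R s t.
Proof.
move=> sK [pc lc]; have [tK e] := chain_size sK pc.
rewrite lc in tK e; rewrite codimE // e; lia.
Qed.

Lemma is_chain_exists s t : (forall k, s (s k) = k) -> (forall k, t (t k) = k) ->
  inle t s -> exists c, is_chain R s t c.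
Proof.
move=> sK tK ts; have [c pc lc] := chain_exists sK tK ts; exists c; split=> //.
elim: c s sK pc {lc ts} => //= f c IH s sK /andP[/asboolP cf pc].
by rewrite (introT (gen_descP _ sK) cf) IH //; case: cf.
Qed.

End Main.

(** * Two-cycles and the minimal involutions *)

Section TwoCycles.
Variable n : nat.
Implicit Types s : 'S_n.

Lemma porbit_invol s k : (forall k, s (s k) = k) -> porbit s k = [set k; s k].
Proof.
move=> sK; apply/setP => y; rewrite !inE; apply/porbitP/orP.
  move=> [m ->]; elim: m => [|m]; first by rewrite expg0 perm1 eqxx; left.
  by rewrite expgSr permM => -[] /eqP ->; rewrite ?sK eqxx; [right | left].
by case=> /eqP ->; [exists 0; rewrite expg0 perm1 | exists 1; rewrite expg1].
Qed.

Lemma card_two_cycles s : (forall k, s (s k) = k) ->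
  #|two_cycles s| = #|[set k : 'I_n | (k < s k)%N]|.
Proof.
move=> sK; rewrite -(card_in_imset (f := porbit s)); last first.
  move=> x y; rewrite !inE => xl yl e.
  have : y \in porbit s x by rewrite e porbit_id.
  rewrite porbit_invol // !inE => /orP[/eqP-> //|/eqP e'].
  by move: yl; rewrite e' sK ltnNge ltnW.
apply: eq_card => c; rewrite inE; apply/andP/imsetP.
  move=> [/imsetP[x _ ->]]; rewrite porbit_invol // cards2.
  case: (ltngtP x (s x)) => h.
  - by exists x; rewrite ?inE // porbit_invol.
  - by exists (s x); rewrite ?inE ?sK // porbit_invol // sK finset.setUC.
  - by rewrite -val_eqE /= h eqxx.
move=> [x]; rewrite inE => xl ->; split; first exact: imset_f.
by rewrite porbit_invol // cards2 -val_eqE /= (ltn_eqF xl).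
Qed.

Lemma card_ord_interval a c : (#|[set x : 'I_n | (a <= x < c)%N]| <= c - a)%N.
Proof.
rewrite -(size_iota a (c - a)) cardE -(size_map val); apply: uniq_leq_size.
  by rewrite map_inj_uniq ?enum_uniq //; apply: val_inj.
move=> y /mapP[x + ->]; rewrite mem_enum inE mem_iota /=; lia.
Qed.

Lemma sigma_oE k (x : 'I_n) : (k + k <= n)%N ->
  sigma_o n k x = (if x < k then n - k + x else
                   if n - k <= x then x - (n - k) else x)%N :> nat.
Proof.
move=> kn.
pose F (i : 'I_n) := (\prod_(j < n | (j == n - k + i :> nat)%N) tperm i j)%g.
have -> : sigma_o n k = (\prod_(i < n | (i < k)%N) F i)%g by [].
(* The effect of the partial product over [r], in a form suited to induction on the list. *)
pose val_of (r : seq 'I_n) (y : 'I_n) := (if (y < k) && (val y \in map val r) then n - k + y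
  else if (n - k <= y) && (y - (n - k) \in map val r) then y - (n - k) else y)%N.
transitivity (val_of (index_enum 'I_n) x); last first.
  have all_in m : (m < n)%N -> m \in map val (index_enum 'I_n).
    by move=> mn; apply/mapP; exists (Ordinal mn); rewrite ?mem_index_enum.
  by have xn := ltn_ord x; rewrite /val_of !all_in ?andbT //; lia.
elim: (index_enum 'I_n) (index_enum_uniq 'I_n) x => [|i r IH] /=.
  by move=> _ x; rewrite big_nil perm1 /val_of /= !andbF.
move=> /andP[ir ur] x; rewrite big_cons; case: ifP => ik; last first.
  rewrite IH // /val_of /= !inE; have xn := ltn_ord x.
  have -> : (x < k)%N && ((x == i :> nat) || (val x \in map val r)) = (x < k)%N && (val x \in map val r).
    by case: (eqVneq (val x) i) => [/= e|//]; suff -> : (x < k)%N = false by []; lia.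
  case: (leqP (n - k) x) => //= h.
  by case: (eqVneq (x - (n - k))%N i) => [e|//]; exfalso; lia.
have jn : (n - k + i < n)%N by lia.
have vir : (val i \in map val r) = false.
  by apply/negbTE; rewrite mem_map //; apply: val_inj.
rewrite /F (big_pred1 (Ordinal jn)) => [|j]; last by rewrite /= -[RHS]val_eqE.
rewrite -/F permM IH // /val_of /= !inE.
case: tpermP => [->|->|/eqP xi /eqP xj] /=.
- by rewrite ik eqxx /= (_ : (n - k + i < k)%N = false) /=; [rewrite addKn vir andbF | lia].
- rewrite ik vir /= (_ : (n - k + i < k)%N = false) /=; last by lia.
  by rewrite leq_addr addKn eqxx /= (_ : (n - k <= i)%N = false) //; lia.
- move: xi xj; rewrite -!val_eqE /= => xi xj.
  rewrite (negbTE xi) /=; case: (leqP (n - k) x) => //= h.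
  by rewrite (_ : (x - (n - k) == i)%N = false) //; lia.
Qed.

Lemma sigma_o_invol k : (k + k <= n)%N -> forall x, sigma_o n k (sigma_o n k x) = x.
Proof.
move=> kn x; apply: val_inj => /=; rewrite sigma_oE // sigma_oE //.
by have xn := ltn_ord x; case: (ltnP x k) => h1; case: (leqP (n - k) x) => h2;
  do ?case: ifP; lia.
Qed.

Lemma sigma_o0 : sigma_o n 0 = 1%g.
Proof. by rewrite /sigma_o big_pred0. Qed.

Lemma card_left_double s : (forall k, s (s k) = k) ->
  (#|[set k : 'I_n | (k < s k)%N]| + #|[set k : 'I_n | (k < s k)%N]| <= n)%N.
Proof.
move=> sK; rewrite -{2}(card_preimset _ (@perm_inj _ s)) -cardsUI.
rewrite (_ : _ :&: _ = finset.set0) ?cards0 ?addn0; last first.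
  by apply/setP => k; rewrite !inE sK; lia.
by rewrite (leq_trans (max_card _)) ?card_ord.
Qed.

(** At most [a] arcs of [s] start before [a] and at most [n - b.+1] end after [b]. The rest lie in
    the window, and [sigma_o n k] has no more there than this count guarantees. *)
Lemma sigma_o_min k s : (forall k, s (s k) = k) -> (k <= #|[set k : 'I_n | (k < s k)%N]|)%N ->
  inle (sigma_o n k) s.
Proof.
move=> sK kl a b bn.
have kn : (k + k <= n)%N by apply: leq_trans (card_left_double sK); apply: leq_add.
have up : (arcs_in (sigma_o n k) a b <= b.+1 + k - n - a)%N.
  apply: leq_trans (card_ord_interval a (b.+1 + k - n)).
  apply/subset_leq_card/fintype.subsetP => x; rewrite !inE sigma_oE //; have xn := ltn_ord x.
  by case: (ltnP x k) => h; [|case: ifP]; lia.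
have c1 : (#|[set x : 'I_n | 0 <= x < a]| <= a)%N.
  by have := card_ord_interval 0 a; rewrite subn0.
have c2 : (#|[set x : 'I_n | b < s x < n]| <= n - b.+1)%N.
  apply: leq_trans (card_ord_interval b.+1 n).
  by rewrite -[X in (_ <= X)%N](card_preimset _ (@perm_inj _ s)) subset_leq_card //; apply/fintype.subsetP => x; rewrite !inE.
have : (#|[set k : 'I_n | k < s k]| <= arcs_in s a b + #|[set x : 'I_n | 0 <= x < a]| + #|[set x : 'I_n | b < s x < n]|)%N.
  rewrite /arcs_in !card_pred_sum -!big_split /=; apply: leq_sum => x _.
  by have := ltn_ord (s x); lia.
lia.
Qed.

End TwoCycles.

Theorem theorem3p6 (R : realType) (n : nat) :
  (forall s s' : 'S_n, s \in invol n -> s' \in invol n ->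
     gen_desc R s s' -> codim R s s' = 1)
  /\ (forall s s' : 'S_n, s \in invol n -> s' \in invol n -> inv_lt R s' s ->
        forall c : seq 'S_n, is_chain R s s' c -> (size c)%:Z = codim R s s')
  /\ (forall (k l : nat) (s : 'S_n), (k <= l)%N -> s \in involk n l ->
        exists2 d : nat, depth_eq R k s d & d%:Z = codim R s (sigma_o n k))
  /\ (forall s : 'S_n, s \in invol n -> depth_eq R 0 s (var_dim (Borbit R s))).
Proof.
have depth k (s : 'S_n) : (forall k, s (s k) = k) -> (k <= #|[set k : 'I_n | (k < s k)%N]|)%N ->
    exists2 d : nat, depth_eq R k s d & d%:Z = codim R s (sigma_o n k).
  move=> sK kl.
  have kn : (k + k <= n)%N by apply: leq_trans (card_left_double sK); apply: leq_add.
  have [c hc] := is_chain_exists R sK (sigma_o_invol kn) (sigma_o_min sK kl).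
  exists (size c); last exact: chain_codim.
  split=> [|c' hc']; first by exists c.
  by have := chain_codim sK hc; rewrite -(chain_codim sK hc') => -[].
split; last split; last split.
- move=> s t /involP sK /involP tK /(gen_descP R _ sK)[_ _ e].
  by rewrite codimE // e; lia.
- by move=> s t /involP sK _ _ c; apply: chain_codim.
- move=> k l s kl; rewrite inE => /andP[/involP sK /eqP].
  by rewrite card_two_cycles // => el; apply: depth; rewrite // el.
- move=> s /involP sK; have [//|d [ex un] dE] := depth 0 s sK.
  suff <- : d = var_dim (Borbit R s) by [].
  (* For the identity all pairs [p <= q] lie in [stab_pairs], so its orbit has dimension 0. *)
  move: dE; rewrite /codim sigma_o0 (var_dim_Borbit R (s := 1%g)); last by move=> k; rewrite !perm1.
  rewrite (_ : free_pairs 1 = finset.set0) ?cards0; first by lia.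
  by apply/setP => -[p q]; rewrite !inE /= !perm1; lia.
Qed.
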